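(* Let $A=(A(k,l))_{k,l\in\mathbb{Z}}$ be a matrix that is invertible in $\mathcal{B}(\ell^2)$. (i) If $r>0$ and $A\in\mathcal{C}_r$, then $A^{-1}\in\mathcal{C}_r$ and $$\|A^{-1}\|_{\mathcal{C}_r}\le C_r\,\|A\|_{\mathcal{C}_r}^{1+\frac1r}\,\|A\|_{\mathcal{B}(\ell^2)}^{2r+\frac1r+3}\,\|A^{-1}\|_{\mathcal{B}(\ell^2)}^{2r+\frac2r+5}\le C_r\,\|A\|_{\mathcal{C}_r}^{2r+\frac2r+4}\,\|A^{-1}\|_{\mathcal{B}(\ell^2)}^{2r+\frac2r+5},$$ where $C_r$ is a constant depending only on $r$. In particular, if $\|A\|_{\mathcal{C}_r}\le1$ and $\|A^{-1}\|_{\mathcal{B}(\ell^2)}\le1/\delta$, then $\|A^{-1}\|_{\mathcal{C}_r}\le C_r\,\delta^{-2r-\frac2r-5}$ as $\delta\to0$. (ii) If $r>1$ and $A\in\mathcal{J}_r$, then $A^{-1}\in\mathcal{J}_r$ and $$\|A^{-1}\|_{\mathcal{J}_r}\le \widetilde{C_r}\,\|A\|_{\mathcal{J}_r}^{1+\frac1{r-1}}\,\|A\|_{\mathcal{B}(\ell^2)}^{2r+1+\frac1{r-1}}\,\|A^{-1}\|_{\mathcal{B}(\ell^2)}^{2r+3+\frac2{r-1}}\le \widetilde{C_r}\,\|A\|_{\mathcal{J}_r}^{2r+2+\frac2{r-1}}\,\|A^{-1}\|_{\mathcal{B}(\ell^2)}^{2r+3+\frac2{r-1}},$$ where $\widetilde{C_r}$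 is a constant depending only on $r$. In particular, if $\|A\|_{\mathcal{J}_r}\le1$ and $\|A^{-1}\|_{\mathcal{B}(\ell^2)}\le1/\delta$, then $\|A^{-1}\|_{\mathcal{J}_r}\le \widetilde{C_r}\,\delta^{-2r-\frac2{r-1}-3}$ as $\delta\to0$. The constants may change from one inequality of a chain to the next, but always depend only on $r$.
   Context: $\mathcal{B}(\ell^2)$ is the algebra of bounded operators on $\ell^2(\mathbb{Z})$ with the operator norm; matrices over $\mathbb{Z}$ are identified with operators. For $r\ge0$, $\mathcal{C}_r$ is the algebra of (convolution-dominated) matrices with finite norm $$\|A\|_{\mathcal{C}_r}=\sum_{k\in\mathbb{Z}}\ \sup_{l\in\mathbb{Z}}|A(l,l-k)|\,(1+|k|)^r .$$ For $r>1$, the Jaffard algebra $\mathcal{J}_r$ consists of the matrices with finite norm $$\|A\|_{\mathcal{J}_r}=\sup_{k,l\in\mathbb{Z}}|A(k,l)|\,(1+|k-l|)^r .$$ *)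

(* Defs.v *)
From HB Require Import structures.
From mathcomp Require Import all_boot all_order all_algebra finmap.
From mathcomp Require Import all_classical all_reals ereal esum exp.
From mathcomp Require Export complex.
From mathcomp Require Import ring lra.

Set Implicit Arguments.
Unset Strict Implicit.
Unset Printing Implicit Defensive.

Import Order.TTheory GRing.Theory Num.Theory.
Import ComplexField.
Import Normc.

Local Open Scope classical_set_scope.
Local Open Scope ring_scope.

Section ell2.
Variable R : realType.
Local Notation C := R[i].
Implicit Types x y : int -> C.

Definition l2sq x : \bar R := \esum_(k in [set: int]) ((normc (x k) ^+ 2)%:E).

Definition square_summable : {pred int -> C} := [pred x | (l2sq x < +oo)%E].

Record ell2 := Ell2 { ell2_val :> int -> C ; _ : ell2_val \in square_summable }.
HB.instance Definition _ := [isSub for ell2_val].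
HB.instance Definition _ := [Choice of ell2 by <:].

Lemma normc_ge0 (z : C) : 0 <= normc z.
Proof. by case: z => a b; exact: sqrtr_ge0. Qed.

Lemma l2sq_ge0 x : (0 <= l2sq x)%E.
Proof. by apply: esum_ge0 => k _; rewrite lee_fin sqr_ge0. Qed.

Lemma l2sq0 : l2sq 0 = 0%E.
Proof. by apply: esum1 => k _; rewrite normc0 expr0n. Qed.

Lemma l2sqZ a x : l2sq (a *: x) = ((normc a ^+ 2)%:E * l2sq x)%E.
Proof.
have [->|a0] := eqVneq a 0.
  by rewrite scale0r l2sq0 normc0 expr0n /= mul0e.
rewrite /l2sq.
under eq_esum do rewrite fctE normcM exprMn EFinM.
have an0 : 0 < normc a.
  rewrite lt_def normc_ge0 andbT; apply: contra a0 => /eqP.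
  by move=> /eq0_normc ->.
have a2 : (0 < normc a ^+ 2) by rewrite exprn_gt0.
set u := fun k => (normc (x k) ^+ 2)%:E : \bar R.
have u0 k : (0 <= u k)%E by rewrite lee_fin sqr_ge0.
have key (c : R) (v : int -> \bar R) : 0 < c -> (forall k, 0 <= v k)%E ->
    (\esum_(k in [set: int]) (c%:E * v k) <=
     c%:E * \esum_(k in [set: int]) v k)%E.
  move=> c0 v0; apply: ge_ereal_sup => _ [F [finF _] <-].
  rewrite -ge0_mule_fsumr//; apply: lee_wpmul2l; first by rewrite lee_fin ltW.
  by apply: ereal_sup_ubound; exists F.
apply/eqP; rewrite eq_le key//=.
have a2' : 0 < (normc a ^+ 2)^-1 by rewrite invr_gt0.
have := key ((normc a ^+ 2)^-1) (fun k => (normc a ^+ 2)%:E * u k)%E a2'.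
have -> : (fun k => ((normc a ^+ 2)^-1%:E * ((normc a ^+ 2)%:E * u k))%E) = u.
  by apply/funext => k; rewrite /u -!EFinM mulKf// gt_eqF.
have au0 k : (0 <= (normc a ^+ 2)%:E * u k)%E.
  by rewrite mule_ge0// lee_fin ltW.
by move=> /(_ au0); rewrite lee_pdivlMl.
Qed.

Lemma l2sqD x y : (l2sq (x + y)%R <= 2%:E * (l2sq x + l2sq y))%E.
Proof.
have -> : (2%:E * (l2sq x + l2sq y) =
    (l2sq x + l2sq y) + (l2sq x + l2sq y))%E by rewrite mule_natl mule2n.
have xy0 k : (0 <= (normc (x k) ^+ 2)%:E + (normc (y k) ^+ 2)%:E :> \bar R)%E.
  by rewrite -EFinD lee_fin addr_ge0// sqr_ge0.
rewrite /l2sq -!esumD; do ?by move=> k _; rewrite // lee_fin sqr_ge0.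
apply: le_esum => k _; rewrite -!EFinD lee_fin fctE.
have := @le_normcD R (x k) (y k); rewrite -/(normc _).
have := normc_ge0 (x k + y k); have := normc_ge0 (x k).
have := normc_ge0 (y k).
set a := normc (x k); set b := normc (y k); set c := normc (x k + y k).
move=> b0 a0 c0 cab.
have : c ^+ 2 <= (a + b) ^+ 2 by rewrite lerXn2r// nnegrE addr_ge0.
move=> /le_trans; apply; have := sqr_ge0 (a - b); nra.
Qed.

Lemma square_summable_submod : subsemimod_closed square_summable.
Proof.
split; first split.
- by rewrite inE l2sq0.
- move=> x y; rewrite !inE => xfin yfin.
  apply: (le_lt_trans (l2sqD x y)).
  by rewrite lte_mul_pinfty// lte_add_pinfty.
- move=> a x; rewrite !inE => xfin.
  by rewrite l2sqZ lte_mul_pinfty// ?lee_fin ?sqr_ge0.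
Qed.

HB.instance Definition _ := GRing.SubChoice_isSubLmodule.Build C (int -> C)
  square_summable ell2 square_summable_submod.

Definition l2norm (x : ell2) : R := Num.sqrt (fine (l2sq x)).

Definition unitvec_fun (l : int) : int -> C := fun k => (k == l)%:R.

Lemma l2sq_unitvec l : l2sq (unitvec_fun l) = 1%E.
Proof.
rewrite /l2sq (esumID [set l])//; last first.
  by move=> k _; rewrite lee_fin sqr_ge0.
rewrite setTI setTI esum_set1 ?lee_fin ?sqr_ge0// /unitvec_fun eqxx normc1.
rewrite expr1n esum1 ?adde0// => k /eqP/negPf ->.
by rewrite normc0 expr0n.
Qed.

Lemma unitvec_subproof l : unitvec_fun l \in square_summable.
Proof. by rewrite inE l2sq_unitvec ltry. Qed.

Definition unitvec l : ell2 := Ell2 (unitvec_subproof l).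

Lemma l2sqE (x : ell2) : l2sq x = (l2norm x ^+ 2)%:E.
Proof.
have xfin : l2sq x \is a fin_num.
  by rewrite ge0_fin_numE ?l2sq_ge0//; exact: (valP x).
by rewrite /l2norm sqr_sqrtr ?fine_ge0 ?l2sq_ge0// fineK.
Qed.

Lemma l2norm_ge0 (x : ell2) : 0 <= l2norm x. Proof. exact: sqrtr_ge0. Qed.

Lemma l2norm0 : l2norm 0 = 0.
Proof. by rewrite /l2norm l2sq0 sqrtr0. Qed.

Lemma l2normZ a (x : ell2) : l2norm (a *: x) = normc a * l2norm x.
Proof.
rewrite /l2norm l2sqZ l2sqE -EFinM /= sqrtrM ?sqr_ge0//.
by rewrite !sqrtr_sqr !ger0_norm ?l2norm_ge0 ?normc_ge0.
Qed.

Lemma l2normD_weak (x y : ell2) :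
  l2norm (x + y) <= 2 * (l2norm x + l2norm y).
Proof.
rewrite -(@ler_pXn2r _ 2)// ?nnegrE ?mulr_ge0 ?addr_ge0 ?l2norm_ge0//.
rewrite -lee_fin -l2sqE; apply: (le_trans (l2sqD x y)).
rewrite !l2sqE -EFinD -EFinM lee_fin.
have := l2norm_ge0 x; have := l2norm_ge0 y; nra.
Qed.

End ell2.

Section bounded_operators.
Variable R : realType.
Local Notation C := R[i].
Local Notation ell2 := (ell2 R).

Definition bounded_operator : {pred ell2 -> ell2} :=
  [pred T | `[< linear T /\
                exists M : R, forall x, l2norm (T x) <= M * l2norm x >]].

Record bop := Bop { bop_val :> ell2 -> ell2 ;
                    _ : bop_val \in bounded_operator }.
HB.instance Definition _ := [isSub for bop_val].
HB.instance Definition _ := [Choice of bop by <:].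

Lemma bopP (T : bop) : linear T /\
  exists M : R, forall x, l2norm (T x) <= M * l2norm x.
Proof. by apply/asboolP; case: T. Qed.

HB.instance Definition _ (T : bop) :=
  GRing.isLinear.Build C ell2 ell2 *:%R (bop_val T) (bopP T).1.

Lemma bop_ext (S T : bop) : S =1 T -> S = T.
Proof. by move=> ST; apply/val_inj/funext. Qed.

Lemma bop_bound (T : bop) :
  exists2 M : R, 0 <= M & forall x, l2norm (T x) <= M * l2norm x.
Proof.
have [_ [M TM]] := bopP T; exists `|M| => // x.
by apply: (le_trans (TM x)); rewrite ler_wpM2r ?l2norm_ge0// ler_norm.
Qed.

Lemma bounded_operator_submod : subsemimod_closed bounded_operator.
Proof.
split; first split.
- apply/asboolP; split.
    by move=> a x y; rewrite -[RHS]/(a *: (0 : ell2) + 0) scaler0 addr0.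
  by exists 0 => x; rewrite mul0r -[X in l2norm X]/(0 : ell2) l2norm0.
- move=> S T Sb Tb; apply/asboolP.
  have [M M0 SM] := bop_bound (Bop Sb); have [N N0 TN] := bop_bound (Bop Tb).
  split.
    move=> a x y; rewrite !fctE.
    have /= -> := linearP (Bop Sb) a x y.
    by have /= -> := linearP (Bop Tb) a x y; rewrite scalerDr addrACA.
  exists (2 * (M + N)) => x; rewrite fctE.
  apply: (le_trans (l2normD_weak _ _)); rewrite -mulrA ler_pM2l// mulrDl.
  exact: lerD (SM x) (TN x).
- move=> c T Tb; apply/asboolP.
  have [M M0 TM] := bop_bound (Bop Tb).
  split.
    move=> a x y; rewrite !fctE.
    by have /= -> := linearP (Bop Tb) a x y;
      rewrite scalerDr !scalerA mulrC.
  exists (normc c * M) => x; rewrite fctE l2normZ -mulrA.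
  by rewrite ler_wpM2l ?normc_ge0//; exact: (TM x).
Qed.

HB.instance Definition _ := GRing.SubChoice_isSubLmodule.Build C (ell2 -> ell2)
  bounded_operator bop bounded_operator_submod.

Lemma bop1_subproof : id \in bounded_operator.
Proof. by apply/asboolP; split=> //; exists 1 => x; rewrite mul1r. Qed.

Lemma bop_comp_subproof (S T : bop) : S \o T \in bounded_operator.
Proof.
apply/asboolP; split; first by move=> a x y /=; rewrite !linearP.
have [M M0 SM] := bop_bound S; have [N N0 TN] := bop_bound T.
exists (M * N) => x; apply: (le_trans (SM _)).
by rewrite -mulrA ler_wpM2l.
Qed.

Definition bop1 : bop := Bop bop1_subproof.
Definition bop_comp (S T : bop) : bop := Bop (bop_comp_subproof S T).

Fact bop_compA : associative bop_comp.
Proof. by move=> S T U; exact: bop_ext. Qed.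
Fact bop_comp1 : left_id bop1 bop_comp.
Proof. by move=> S; exact: bop_ext. Qed.
Fact bop_1comp : right_id bop1 bop_comp.
Proof. by move=> S; exact: bop_ext. Qed.
Fact bop_compDl : left_distributive bop_comp +%R.
Proof. by move=> S T U; exact: bop_ext. Qed.
Fact bop_compDr : right_distributive bop_comp +%R.
Proof. by move=> S T U; apply: bop_ext => x; exact: linearD. Qed.
Fact bop1_neq0 : bop1 != 0.
Proof.
apply/eqP => /(congr1 (fun T : bop => T (unitvec R 0) : int -> C)).
by move=> /(congr1 (fun f => f 0)) /eqP; rewrite /= /unitvec_fun eqxx oner_eq0.
Qed.

HB.instance Definition _ := GRing.Zmodule_isNzRing.Build bop
  bop_compA bop_comp1 bop_1comp bop_compDl bop_compDr bop1_neq0.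

Fact bop_scaleAl (a : C) (S T : bop) : a *: (S * T) = (a *: S) * T.
Proof. exact: bop_ext. Qed.
HB.instance Definition _ := GRing.Lmodule_isLalgebra.Build C bop bop_scaleAl.
Fact bop_scaleAr (a : C) (S T : bop) : a *: (S * T) = S * (a *: T).
Proof. by apply: bop_ext => x; apply/esym/linearZ. Qed.
HB.instance Definition _ := GRing.Lalgebra_isAlgebra.Build C bop bop_scaleAr.

Definition bop_invertible (T : bop) (S : bop) := S * T = 1 /\ T * S = 1.

Definition bop_unit : pred bop := [pred T | `[< exists S, bop_invertible T S >]].

Definition bop_inv (T : bop) : bop := xget T [set S | bop_invertible T S].

Lemma bop_invP T : T \in bop_unit -> bop_invertible T (bop_inv T).
Proof. by move=> /asboolP[S TS]; rewrite /bop_inv; case: xgetP => // /(_ S). Qed.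

Fact bop_mulVr : {in bop_unit, left_inverse 1 bop_inv *%R}.
Proof. by move=> T /bop_invP[]. Qed.
Fact bop_divrr : {in bop_unit, right_inverse 1 bop_inv *%R}.
Proof. by move=> T /bop_invP[]. Qed.
Fact bop_unitrP (S T : bop) : T * S = 1 /\ S * T = 1 -> bop_unit S.
Proof. by move=> ST; apply/asboolP; exists T. Qed.
Fact bop_inv_out : {in [predC bop_unit], bop_inv =1 id}.
Proof.
move=> T; rewrite inE /= => /asboolP TN; rewrite /bop_inv.
by case: xgetP => // S _ TS; exfalso; apply: TN; exists S.
Qed.

HB.instance Definition _ := GRing.NzRing_hasMulInverse.Build bop
  bop_mulVr bop_divrr bop_unitrP bop_inv_out.

Definition opnorm (T : bop) : \bar R :=
  ereal_sup [set (l2norm (T x))%:E | x in [set x : ell2 | l2norm x <= 1]].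

(* The entry (k, l) is the inner product <T e_l, e_k>; by [bop_mxE] below the
   matrix acts on ell2 by the usual matrix-vector product and hence
   determines T. *)
Definition bop_mx (T : bop) (k l : int) : C := T (unitvec R l) k.

Lemma normc_le_l2norm (x : ell2) k : normc (x k) <= l2norm x.
Proof.
rewrite -(@ler_pXn2r _ 2)// ?nnegrE ?l2norm_ge0 ?normc_ge0//.
rewrite -lee_fin -l2sqE /l2sq (esumID [set k])//; last first.
  by move=> i _; rewrite lee_fin sqr_ge0.
rewrite setTI esum_set1 ?lee_fin ?sqr_ge0// leeDl//.
by apply: esum_ge0 => i _; rewrite lee_fin sqr_ge0.
Qed.

Lemma bop_mxE (T : bop) (x : ell2) k (e : R) : 0 < e ->
  exists2 F : set int, finite_set F & forall G : set int, finite_set G ->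
    F `<=` G -> normc (T x k - \sum_(l \in G) bop_mx T k l * x l) < e.
Proof.
move=> e0; have [M M0 TM] := bop_bound T.
set d := e / (M + 1).
have d0 : 0 < d by rewrite divr_gt0// ltr_wpDl.
have : (l2sq x - (d ^+ 2)%:E < l2sq x)%E.
  by rewrite l2sqE -EFinB lte_fin gtrDl oppr_lt0 exprn_gt0.
move=> /ereal_sup_gt[_ [F [finF _] <-]] xF.
exists F => // G finG FG.
pose y : ell2 := \sum_(l <- fset_set G) x l *: unitvec R l.
have yE j : y j = if j \in G then x j else 0.
  rewrite -[y j]/(val y j) /y raddf_sum/= fct_sumE.
  rewrite (eq_bigr (fun l => x l * (j == l)%:R))//.
  case: ifPn => [jG|/negP jG].
    rewrite (big_fsetD1 j) ?in_fset_set//= eqxx mulr1 big1_seq ?addr0//.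
    by move=> l /andP[_]; rewrite !inE eq_sym => /andP[/negPf -> _]; rewrite mulr0.
  rewrite big1_seq// => l /andP[_]; rewrite in_fset_set// => lG.
  by case: eqP => [jl|]; [exfalso; apply: jG; rewrite jl|rewrite mulr0].
have -> : T x k - \sum_(l \in G) bop_mx T k l * x l = T (x - y) k.
  rewrite linearB -[RHS]/(T x k - T y k); congr (_ - _).
  rewrite /y linear_sum -[RHS]/(val (\sum_(l <- _) _ : ell2) k) raddf_sum/=.
  rewrite fct_sumE fsbig_finite//=; apply: eq_bigr => l _.
  by rewrite linearZ mulrC.
apply: (le_lt_trans (normc_le_l2norm _ _)).
apply: (le_lt_trans (TM _)).
have xyd : l2norm (x - y) < d.
  rewrite -(@ltr_pXn2r _ 2)// ?nnegrE ?l2norm_ge0 ?(ltW d0)//.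
  rewrite -lte_fin -l2sqE.
  have Efin : (l2sq x = \esum_(l in G) (normc (x l) ^+ 2)%:E + l2sq (x - y)%R)%E.
    rewrite /l2sq (esumID G)//; last by move=> i _; rewrite lee_fin sqr_ge0.
    rewrite !setTI; congr (_ + _)%E; rewrite esum_mkcond; apply: eq_esum => l _.
    rewrite -[(x - y)%R l]/(x l - y l) yE in_setC.
    by case: (l \in G) => /=; rewrite ?subr0// subrr normc0 expr0n.
  have FGs : (\sum_(l \in F) (normc (x l) ^+ 2)%:E <=
      \esum_(l in G) (normc (x l) ^+ 2)%:E)%E.
    by apply: ereal_sup_ubound; exists F.
  have Gfin : (\esum_(l in G) (normc (x l) ^+ 2)%:E \is a fin_num)%E.
    rewrite ge0_fin_numE; last by apply: esum_ge0 => l _; rewrite lee_fin sqr_ge0.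
    rewrite (@le_lt_trans _ _ (l2sq x))//; last by rewrite l2sqE ltry.
    by rewrite Efin leeDl ?l2sq_ge0.
  move: xF FGs Efin; rewrite !l2sqE -(fineK Gfin).
  set g := fine _; set s := (X in (_ < X)%E); move=> sx sg [xg].
  have := lt_le_trans sx sg; rewrite -EFinB !lte_fin; lra.
apply: (@le_lt_trans _ _ (M * d)); first by rewrite ler_wpM2l// ltW.
by rewrite /d mulrCA gtr_pMr// ltr_pdivrMr ?mul1r ?ltrDl// ltr_wpDl.
Qed.

End bounded_operators.

Section matrix_norms.
Variable R : realType.
Implicit Types (r : R) (A : int -> int -> R[i]).
Local Open Scope ereal_scope.

Definition convdom_norm r A : \bar R :=
  \esum_(k in [set: int])
    (ereal_sup [set (normc (A l (l - k)%R))%:E | l in [set: int]] *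
     ((1 + (absz k)%:R) `^ r)%:E).

Definition jaffard_norm r A : \bar R :=
  ereal_sup [set (normc (A kl.1 kl.2) * (1 + (absz (kl.1 - kl.2))%:R) `^ r)%:E
            | kl in [set: int * int]].

Definition convdom r : set (int -> int -> R[i]) :=
  [set A | convdom_norm r A < +oo].

Definition jaffard r : set (int -> int -> R[i]) :=
  [set A | jaffard_norm r A < +oo].

End matrix_norms.

(* Main.v *)
Require Import Defs.
From mathcomp Require Import all_boot all_order all_algebra finmap.
From mathcomp Require Import all_classical all_reals ereal esum exp.
From mathcomp Require Import topology normedtype sequences.
From mathcomp Require Import zify ring lra.

Set Implicit Arguments.
Unset Strict Implicit.
Unset Printing Implicit Defensive.

Import Order.TTheory GRing.Theory Num.Theory.
Local Open Scope classical_set_scope.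
Local Open Scope ring_scope.

(** Write [a], [K] for the operator norms of [A] and [A^-1], and [u e] for the
    supremum of [|A(l, l - e)|] over [l].  Both matrix norms are a norm [p] of
    the sequence [u]: a weighted l1 norm, or a weighted sup norm.  The two
    cases are run together.  Put [s = r] for the convolution-dominated norm
    and [s = r - 1] for the Jaffard norm; the exponents of the two halves of
    the statement are then the same functions of [s], and all that is used
    about [p] is collected in [decay_norm], of which the central clause is
    that the tail sum of [u] beyond [n] is at most [n^(-s) p u] up to a
    constant.

    The inverse is controlled by localising it, after Sjostrand.  Cut the
    index set into fine blocks of length [n] and coarse blocks of length
    [L = n M], and let [P_m] restrict to the coarse block [m].  Let [chi_k] be
    a trapezoid equal to 1 on the coarse block [k], vanishing outside its
    neighbours, and constant on fine blocks, with jumps at most [1 / M].  As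
    [A] is bounded below by [1 / K],

      [|P_k x| <= |chi_k x| <= K |chi_k A x| + K \sum_m |[A, chi_k] P_m| |P_m x|].

    The commutators are small.  For nearby [k], [m] the entries of [A] between
    adjacent fine blocks see a jump [1 / M] of [chi_k], and since every fine
    block has only two neighbours this part has norm [O(a / M)]: the operator
    norm of [A] enters here, not [p u].  The other entries are at distance at
    least [n] from the diagonal, and Schur's test bounds their contribution by
    a tail of [u], that is, by [O(n^(-s) p u)].  For distant [k], [m] only
    entries of [A] close to the diagonal number [(k - m) L] remain.  Thus
    ([piece_kernel]) the commutators are bounded by a kernel in [k - m].  With
    [M ~ K a] and [n ~ (K p u)^(1/s)], the l1 norm of [K] times this kernel is
    as small as desired, and its norm [p] is bounded by a constant.

    Apply this to the columns [x] of [A^-1]: then [A x] is a unit vector.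
    The largest size [b d] of a column of [A^-1] at coarse distance [d]
    satisfies [b <= f + v * b] with [v] as above and [f] supported near [0];
    iterating the inequality ([renewal]) gives [p b <= C K].  Passing from
    coarse blocks back to single entries costs a factor [L^(s+1)], so

      [p (A^-1) <= C K L^(s+1) ~ (p u)^(1+1/s) a^(s+1) K^(s+3+1/s)]

    ([decay_inverse]).  The exponents of the statement follow upon multiplying
    by a power of [a K >= 1], and the remaining inequalities from
    [a <= D (p u)]. *)

(** * Sums, convolutions and the renewal inequality *)

Section sums.
Variable R : realType.
Local Open Scope ereal_scope.

Lemma esumZ_le (T : choiceType) (A : set T) (c : \bar R) (a : T -> \bar R) :
  0 <= c -> (forall i, 0 <= a i) ->
  \esum_(i in A) (c * a i) <= c * \esum_(i in A) a i.
Proof.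
move=> c0 a0; apply: ge_ereal_sup => _ [F [finF FA] <-].
rewrite -ge0_mule_fsumr//; apply: lee_wpmul2l => //.
by apply: ereal_sup_ubound; exists F.
Qed.

Lemma esumZ (T : choiceType) (A : set T) (c : R) (a : T -> \bar R) :
  (0 <= c)%R -> (forall i, 0 <= a i) ->
  \esum_(i in A) (c%:E * a i) = c%:E * \esum_(i in A) a i.
Proof.
rewrite le_eqVlt => /predU1P[<- a0|c0 a0].
  by rewrite mul0e esum1// => i _; rewrite mul0e.
apply/eqP; rewrite eq_le; apply/andP; split.
  by apply: esumZ_le => //; rewrite lee_fin ltW.
rewrite -lee_pdivlMl//; apply: le_trans (esumZ_le _ _ _) => //.
- apply: le_esum => i _; rewrite muleA -EFinM mulVf ?mul1e ?gt_eqF//.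
- by rewrite lee_fin invr_ge0 ltW.
- by move=> i; rewrite mule_ge0// lee_fin ltW.
Qed.

Lemma exchange_esum (T1 T2 : choiceType) (A : set T1) (B : set T2)
    (a : T1 -> T2 -> \bar R) : (forall i j, 0 <= a i j) ->
  \esum_(i in A) \esum_(j in B) a i j = \esum_(j in B) \esum_(i in A) a i j.
Proof.
move=> a0; rewrite !esum_esum//.
rewrite (@reindex_esum _ _ _ (A `*`` fun=> B) (B `*`` fun=> A)
  (fun k => (k.2, k.1)))//; split.
- by move=> [i j] /= [].
- by move=> [i j] [i' j'] _ _ [-> ->].
- by move=> [j i] /= [Bj Ai]; exists (i, j).
Qed.

Lemma esum_setT_bij (f g : int -> int) (a : int -> \bar R) :
  cancel f g -> cancel g f ->
  \esum_(d in [set: int]) a (f d) = \esum_(d in [set: int]) a d.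
Proof.
move=> fg gf; symmetry; apply: reindex_esum; split => //.
- by move=> x y _ _ /(congr1 g); rewrite !fg.
- by move=> y _; exists (g y).
Qed.

(** Replaces a cardinality bound: [S] has at most [size s] elements. *)
Lemma esum_cover (T : choiceType) (S : set T) (s : seq T) (c : \bar R) :
  0 <= c -> (forall x, S x -> x \in s) ->
  \esum_(x in S) c <= (size s)%:R%:E * c.
Proof.
move=> c0 Ss; rewrite esum_mkcond.
have le : \esum_(x in [set: T]) (if x \in S then c else 0) <=
    \esum_(x in [set: T]) \sum_(t <- s) (if x \in [set t] then c else 0).
  apply: le_esum => x _; case: ifPn => [|_]; last first.
    by apply: sume_ge0 => t _; case: ifP.
  rewrite inE => /Ss xs; rewrite (big_rem x)//= ifT ?inE// leeDl//.
  by apply: sume_ge0 => t _; case: ifP.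
apply: (le_trans le); rewrite esum_sum; last by move=> t x _ _; case: ifP.
under eq_bigr do rewrite -esum_mkcond esum_set1//.
by rewrite big_const_seq count_predT mule_natl -[leLHS]/(iter _ (+%R c) 0%R) iter_addr_0.
Qed.

Definition conv (v g : int -> \bar R) (d : int) : \bar R :=
  \esum_(m in [set: int]) v m * g (d - m)%R.

(** The condition [n <= |e| + 1], rather than [n <= |e|], makes [tail 1] the
    full sum and fits the weights [(1 + |e|)^r]. *)
Definition tail (n : nat) (u : int -> \bar R) : \bar R :=
  \esum_(e in [set e : int | (n <= (absz e).+1)%N]) u e.

(** Bounds the entries of [A] linking the surroundings of the coarse block
    [k = m + d] to the coarse block [m].  For [|d| >= 3] the indices [e] that
    occur satisfy [L <= |e|]; the smaller [d] are accounted for separately. *)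
Definition far (L : nat) (u : int -> \bar R) (d : int) : \bar R :=
  if (3 <= absz d)%N then
    \esum_(e in [set e : int | (absz (e - d * L%:Z)%R < 2 * L)%N]) u e
  else 0.

Lemma conv_ge0 v g : (forall d, 0 <= v d) -> (forall d, 0 <= g d) ->
  forall d, 0 <= conv v g d.
Proof. by move=> v0 g0 d; apply: esum_ge0 => m _; rewrite mule_ge0. Qed.

Lemma le_conv v g h : (forall d, 0 <= v d) -> (forall d, g d <= h d) ->
  forall d, conv v g d <= conv v h d.
Proof. by move=> v0 gh d; apply: le_esum => m _; rewrite lee_wpmul2l. Qed.

Lemma convC v g d : conv v g d = conv g v d.
Proof.
rewrite /conv -(@esum_setT_bij (fun m => d - m)%R (fun m => d - m)%R).
- by apply: eq_esum => m _; rewrite muleC opprB addrC subrK.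
- by move=> m; rewrite opprB addrC subrK.
- by move=> m; rewrite opprB addrC subrK.
Qed.

Lemma conv_cst_le v (c : \bar R) d : 0 <= c -> (forall d, 0 <= v d) ->
  conv v (fun=> c) d <= c * \esum_(m in [set: int]) v m.
Proof.
move=> c0 v0; rewrite /conv.
under eq_esum do rewrite muleC.
exact: esumZ_le.
Qed.

Lemma convD v g h d : (forall d, 0 <= v d) -> (forall d, 0 <= g d) ->
  (forall d, 0 <= h d) ->
  conv v (fun d => g d + h d) d = conv v g d + conv v h d.
Proof.
move=> v0 g0 h0; rewrite /conv -esumD.
- by apply: eq_esum => m _; rewrite ge0_muleDr.
- by move=> m _; rewrite mule_ge0.
- by move=> m _; rewrite mule_ge0.
Qed.

Lemma esum_conv_le v g : (forall d, 0 <= v d) -> (forall d, 0 <= g d) ->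
  \esum_(d in [set: int]) conv v g d <=
  (\esum_(d in [set: int]) v d) * \esum_(d in [set: int]) g d.
Proof.
move=> v0 g0; rewrite /conv exchange_esum; last by move=> d m; rewrite mule_ge0.
rewrite [leRHS]muleC; apply: le_trans (esumZ_le _ _ _) => //; last exact: esum_ge0.
apply: le_esum => m _; apply: (le_trans (esumZ_le _ _ _)) => //.
by rewrite (@esum_setT_bij (fun d => d - m)%R (fun d => d + m)%R) 1?muleC//
  => d; rewrite ?subrK ?addrK.
Qed.

Lemma far_ge0 L u : (forall e, 0 <= u e) -> forall d, 0 <= far L u d.
Proof. by move=> u0 d; rewrite /far; case: ifP => // _; exact: esum_ge0. Qed.

(** The three facts about the index window of [far]: it stays away from the
    diagonal, [|e|] is comparable to [|d| L] in it, and a given [e] belongs to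
    at most four windows. *)
Lemma far_index (L : nat) (e d : int) : (3 <= absz d)%N ->
  (absz (e - d * L%:Z)%R < 2 * L)%N ->
  [/\ (L <= absz e)%N, ((absz d).+1 * L <= 4 * (absz e).+1)%N &
   d \in [seq ((e %/ L%:Z)%Z + j)%R | j <- [:: -1; 0; 1; 2]%R]].
Proof.
move=> d3 ed.
have L0 : (0 < L)%N by lia.
have dLE : absz (d * L%:Z)%R = (absz d * L)%N by rewrite abszM.
have d3L : (3 * L <= absz d * L)%N by rewrite leq_mul2r d3 orbT.
split; [lia|lia|].
have eE := divz_eq e L%:Z.
have /andP[r0 rL] : ((0 <= (e %% L%:Z)%Z) && ((e %% L%:Z)%Z < L%:Z))%R.
  by rewrite modz_ge0 ?ltz_mod ?gt_eqF// -?lt0n ?ltz_nat.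
set q := (e %/ L%:Z)%Z in eE *; set t := (e %% L%:Z)%Z in eE r0 rL.
have {}ed : (absz ((q - d) * L%:Z + t)%R < 2 * L)%N.
  by move: ed; rewrite {1}eE mulrBl addrAC.
have h1 : (- 2 <= q - d)%R.
  rewrite leNgt; apply/negP => h.
  have : ((q - d) * L%:Z <= - 3 * L%:Z)%R by rewrite ler_wpM2r//; lia.
  lia.
have h2 : (q - d <= 1)%R.
  rewrite leNgt; apply/negP => h.
  have : (2 * L%:Z <= (q - d) * L%:Z)%R by rewrite ler_wpM2r//; lia.
  lia.
rewrite /= !inE.
have : [\/ q - d = -2, q - d = -1, q - d = 0 | q - d = 1]%R.
  have : (q - d = -2 \/ q - d = -1 \/ q - d = 0 \/ q - d = 1)%R by lia.
  by move=> [|[|[|]]] ->; constructor.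
by case=> h; apply/or4P; [apply: Or44|apply: Or43|apply: Or42|apply: Or41];
  apply/eqP; lia.
Qed.

Lemma esum_far_le L (u : int -> \bar R) (f : int -> R) (g : int -> \bar R) :
  (forall e, 0 <= u e) -> (forall d, 0 <= f d)%R -> (forall d, 0 <= g d) ->
  (forall d e, (3 <= absz d)%N -> (absz (e - d * L%:Z)%R < 2 * L)%N ->
     (f d)%:E <= g e) ->
  \esum_(d in [set: int]) (far L u d * (f d)%:E) <=
  4%:E * \esum_(e in [set e : int | (L <= absz e)%N]) (u e * g e).
Proof.
move=> u0 f0 g0 fg.
pose P := [set de : int * int | (3 <= absz de.1)%N /\
  (absz (de.2 - de.1 * L%:Z)%R < 2 * L)%N].
have ug0 e : 0 <= u e * g e by rewrite mule_ge0.
have step d : far L u d * (f d)%:E <=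
    \esum_(e in [set: int]) (if (d, e) \in P then u e * g e else 0).
  rewrite /far; case: ifPn => [d3|_]; last first.
    by rewrite mul0e; apply: esum_ge0 => e _; case: ifP.
  rewrite muleC -esumZ// esum_mkcond; apply: le_esum => e _.
  case: ifPn => [|_]; last by case: ifP.
  rewrite inE /= => ed; rewrite ifT; last by rewrite inE.
  by rewrite muleC lee_wpmul2l// fg.
apply: (le_trans (le_esum (fun d _ => step d))).
rewrite exchange_esum; last by move=> d e; case: ifP.
rewrite -esumZ// [leRHS]esum_mkcond; apply: le_esum => e _.
rewrite -(esum_mkcond [set d | P (d, e)]).
rewrite (_ : [set d | P (d, e)] = [set d | (d, e) \in P]); last first.
  by apply/seteqP; split => d; rewrite /= inE.
case: ifPn => [eL|/negP eL].
  pose s := [seq ((e %/ L%:Z)%Z + j)%R | j <- [:: -1; 0; 1; 2]%R].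
  apply: (@le_trans _ _ ((size s)%:R%:E * (u e * g e))) => //.
  by apply: esum_cover => // d /set_mem[d3 ed]; have [] := far_index d3 ed.
rewrite esum1// => d /set_mem[d3 ed]; exfalso; apply: eL.
by rewrite inE; have [] := far_index d3 ed.
Qed.

Lemma esum_le_tail n u : (forall e, 0 <= u e) ->
  \esum_(e in [set e : int | (n <= absz e)%N]) u e <= tail n u.
Proof.
move=> u0; rewrite /tail esum_mkcond [leRHS]esum_mkcond; apply: le_esum => e _.
case: ifPn => [|_]; last by case: ifP.
by rewrite inE /= => ne; rewrite ifT// inE /= ltnW.
Qed.

Lemma esum_tail1 u : tail 1 u = \esum_(e in [set: int]) u e.
Proof. by congr (esum _ u); apply/seteqP; split. Qed.

Lemma le_tail (n L : nat) u : (n <= L)%N ->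
  (forall e, 0 <= u e)%E -> (tail L u <= tail n u)%E.
Proof.
move=> nL u0; rewrite /tail esum_mkcond [leRHS]esum_mkcond; apply: le_esum => e _.
case: ifPn => [|_]; last by case: ifP.
by rewrite inE /= => Le; rewrite ifT// inE /= (leq_trans nL).
Qed.

Lemma esum_near : (\esum_(d in [set: int])
  (if (absz d <= 2)%N then 1 else 0 : \bar R) <= 5%:E)%E.
Proof.
apply: (@le_trans _ _ (\esum_(d in [set d : int | (absz d <= 2)%N]) (1 : \bar R)))%E.
  rewrite [leRHS]esum_mkcond; apply: le_esum => d _.
  by case: ifPn => d2; [rewrite ifT// inE|case: ifP].
apply: (le_trans (@esum_cover _ _ [:: -2; -1; 0; 1; 2]%R _ _ _)) => //.
  by move=> d /=; rewrite !inE; lia.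
by rewrite mule1.
Qed.

Lemma esum_far L u : (forall e, 0 <= u e) ->
  \esum_(d in [set: int]) far L u d <= 4%:E * tail L u.
Proof.
move=> u0.
have h : \esum_(d in [set: int]) (far L u d * 1) <=
    4%:E * \esum_(e in [set e : int | (L <= absz e)%N]) (u e * 1).
  by apply: (@esum_far_le L u (fun=> 1%R) (fun=> 1)).
move: h; under eq_esum do rewrite mule1.
move=> /le_trans; apply; rewrite lee_wpmul2l//.
under eq_esum do rewrite mule1.
exact: esum_le_tail.
Qed.

(** What the localisation argument needs from a norm [p] on sequences over the
    integers, with one constant [D] for all clauses.  The weighted l1 norm of
    exponent [s] and the weighted sup norm of exponent [s + 1] both qualify.
    [decay_conv] is the Leibniz-type inequality behind the control of
    iterated convolutions; [decay_lim] is lower semicontinuity;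
    [decay_tail] and [decay_far] trade decay for smallness;
    [decay_dilate] is the cost of spreading a value per coarse block over the
    whole block. *)
Record decay_norm (s D : R) (p : (int -> \bar R) -> \bar R) : Prop := DecayNorm {
  decay_gt0 : (0 < s)%R;
  decay_ge1 : (1 <= D)%R;
  decay_le : forall f g, (forall d, f d <= g d) -> p f <= p g;
  decay_add : forall f g, (forall d, 0 <= f d) -> (forall d, 0 <= g d) ->
    p (fun d => f d + g d) <= p f + p g;
  decay_scale : forall (c : R) g, (0 <= c)%R -> (forall d, 0 <= g d) ->
    p (fun d => c%:E * g d) <= c%:E * p g;
  decay_lim : forall b B, (forall e : R, (0 < e)%R -> exists h,
      [/\ forall d, 0 <= h d, p h <= B & forall d, b d <= h d + e%:E]) ->
    p b <= B;
  decay_near : p (fun d => if (absz d <= 2)%N then 1 else 0) <= D%:E;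
  decay_conv : forall v g, (forall d, 0 <= v d) -> (forall d, 0 <= g d) ->
    p (conv v g) <= D%:E * ((\esum_(d in [set: int]) v d) * p g
                            + p v * \esum_(d in [set: int]) g d);
  decay_tail : forall n u, (0 < n)%N -> (forall d, 0 <= u d) ->
    tail n u <= (D * n%:R `^ (- s))%:E * p u;
  decay_far : forall L u, (0 < L)%N -> (forall d, 0 <= u d) ->
    p (far L u) <= (D * L%:R `^ (- s))%:E * p u;
  decay_dilate : forall L u, (0 < L)%N -> (forall d, 0 <= u d) ->
    p (fun e => u (e %/ L%:Z)%Z + u ((e %/ L%:Z)%Z + 1)%R) <=
    (D * L%:R `^ (s + 1))%:E * p u }.

Section renewal.
Variables (s D : R) (p : (int -> \bar R) -> \bar R).
Hypothesis pP : decay_norm s D p.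

Lemma decay_norm0 : p (fun=> 0) <= 0.
Proof.
have {1}-> : (fun=> 0) = (fun d : int => 0%:E * 0) :> (int -> \bar R).
  by apply/funext => d; rewrite mul0e.
by apply: (le_trans (decay_scale pP _ _)); rewrite ?mul0e.
Qed.

(** Solves [b <= f + v * b] for a bounded [b] when [v] has small l1 norm.  The
    iterates [g 0 = 0], [g (n + 1) = f + v * g n] have [\sum g n] and [p (g n)]
    bounded uniformly in [n], and [b] exceeds [g n] by at most [2^(-n) k].
    Going through the iterates avoids assuming that [p b] is finite. *)
Lemma renewal (v f b : int -> \bar R) (k eta F V F1 : R) :
  (forall d, 0 <= v d) -> (forall d, 0 <= f d) ->
  (0 <= k)%R -> (0 <= F)%R -> (0 <= V)%R ->
  (forall d, b d <= k%:E) -> (forall d, b d <= f d + conv v b d) ->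
  \esum_(d in [set: int]) v d <= eta%:E -> (2 * D * eta <= 1)%R ->
  p f <= F%:E -> p v <= V%:E -> \esum_(d in [set: int]) f d <= F1%:E ->
  p b <= (2 * (F + 2 * D * V * F1))%:E.
Proof.
move=> v0 f0 k0 F0 V0 bk bfv veta Deta pf pv fF1.
have D1 := decay_ge1 pP.
have eta0 : (0 <= eta)%R.
  by rewrite -lee_fin; apply: le_trans veta; apply: esum_ge0.
have F10 : (0 <= F1)%R.
  by rewrite -lee_fin; apply: le_trans fF1; apply: esum_ge0.
have eta1 : (2 * eta <= 1)%R by nra.
pose g n := iter n (fun h d => f d + conv v h d) (fun=> 0).
have g0 n d : 0 <= g n d.
  elim: n d => [|n IH] d //=; rewrite adde_ge0//; exact: conv_ge0.
have gsum n : \esum_(d in [set: int]) g n d <= (2 * F1)%:E.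
  elim: n => [|n IH].
    by rewrite esum1// lee_fin mulr_ge0.
  rewrite /= esumD//; last by move=> d _; apply: conv_ge0.
  apply: (@le_trans _ _ (F1%:E + eta%:E * (2 * F1)%:E)).
    apply: leeD => //; apply: (le_trans (esum_conv_le _ _)) => //.
    by apply: lee_pmul => //; apply: esum_ge0.
  by rewrite -EFinM -EFinD lee_fin; nra.
set B := (2 * _)%R.
have B0 : (0 <= B)%R by rewrite /B mulr_ge0// addr_ge0// !mulr_ge0//; lra.
have gp n : p (g n) <= B%:E.
  elim: n => [|n IH].
    by apply: (le_trans decay_norm0); rewrite lee_fin.
  rewrite -[g n.+1]/(fun d => f d + conv v (g n) d).
  apply: (le_trans (decay_add pP _ _)) => //; first exact: conv_ge0.
  apply: (@le_trans _ _ (F%:E + D%:E * (eta%:E * B%:E + V%:E * (2 * F1)%:E))).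
    apply: leeD => //; apply: (le_trans (decay_conv pP _ _)) => //.
    apply: lee_wpmul2l; first by rewrite lee_fin; lra.
    apply: leeD.
      apply: (@le_trans _ _ ((\esum_(d in [set: int]) v d) * B%:E)).
        by rewrite lee_wpmul2l// esum_ge0.
      by rewrite lee_wpmul2r.
    apply: (@le_trans _ _ (V%:E * \esum_(d in [set: int]) g n d)).
      by rewrite lee_wpmul2r// esum_ge0.
    by rewrite lee_wpmul2l.
  rewrite -(EFinM eta B) -(EFinM V) -(EFinD (eta * B)) -(EFinM D) -EFinD lee_fin.
  have : (2 * D * eta * B <= 1 * B)%R by rewrite ler_wpM2r.
  rewrite mul1r => DB.
  have BE : B = (2 * F + 4 * (D * (V * F1)))%R by rewrite /B; ring.
  have -> : (F + D * (eta * B + V * (2 * F1)) =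
    F + 2 * (D * (V * F1)) + (2 * D * eta * B) / 2)%R by field.
  lra.
have bg n d : b d <= g n d + (2^-1 ^+ n * k)%:E.
  elim: n d => [|n IH] d; first by rewrite expr0 mul1r add0e.
  apply: (le_trans (bfv d)); rewrite /= -addeA leeD2l//.
  apply: (le_trans (le_conv v0 IH d)).
  rewrite convD// ?leeD2l//; last first.
    by move=> _; rewrite lee_fin mulr_ge0// exprn_ge0.
  apply: (le_trans (conv_cst_le _ _ _)) => //.
    by rewrite lee_fin mulr_ge0// exprn_ge0.
  apply: (@le_trans _ _ ((2^-1 ^+ n * k)%:E * eta%:E)).
    by rewrite lee_wpmul2l// lee_fin mulr_ge0// exprn_ge0.
  rewrite -EFinM lee_fin exprS mulrAC ler_wpM2r//.
  by rewrite mulrC ler_wpM2r ?exprn_ge0//; lra.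
apply: (decay_lim pP) => e e0.
have [n nk] : exists n, (2^-1 ^+ n * k <= e)%R.
  exists (Num.bound (k / e)); rewrite exprVn mulrC ler_pdivrMr ?exprn_gt0//.
  rewrite -ler_pdivrMl// mulrC ltW//; apply: lt_trans (archi_boundP _) _.
    by rewrite divr_ge0// ltW.
  by rewrite -natrX ltr_nat ltn_expl.
exists (g n); split => // d.
by apply: (le_trans (bg n d)); rewrite leeD2l// lee_fin.
Qed.

End renewal.

End sums.

(** * The two weighted sequence norms *)

Section weights.
Variable R : realType.
Implicit Types (r s : R) (d e m : int).

Definition weight r d : R := (1 + (absz d)%:R) `^ r.

Lemma weight_gt0 r d : 0 < weight r d.
Proof. by rewrite powR_gt0// ltr_wpDr. Qed.

Lemma weight_ge0 r d : 0 <= weight r d.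
Proof. exact/ltW/weight_gt0. Qed.

Hint Resolve weight_ge0 : core.

Lemma le_powR_scale r (a x y : R) : 0 <= r -> 0 <= a -> 0 <= x -> 0 <= y ->
  x <= a * y -> x `^ r <= a `^ r * y `^ r.
Proof.
move=> r0 a0 x0 y0 xay; rewrite -powRM// ge0_ler_powR// nnegrE//.
exact: mulr_ge0.
Qed.

(** The larger of [|m|] and [|d - m|] is at least half of [|d|]. *)
Lemma weight_conv r d m : 0 <= r ->
  weight r d <= 2 `^ r * (weight r m + weight r (d - m)).
Proof.
move=> r0.
have key x y : (absz x <= absz y)%N -> (absz d <= absz x + absz y)%N ->
    weight r d <= 2 `^ r * weight r y.
  move=> xy dxy; apply: le_powR_scale => //; rewrite ?addr_ge0//.
  rewrite -!(natrD _ 1%N) -natrM ler_nat; lia.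
have P2 : 0 <= 2 `^ r :> R by exact: powR_ge0.
case: (leqP (absz m) (absz (d - m))) => h.
  apply: (le_trans (key _ _ h _)); first by lia.
  by rewrite ler_wpM2l// lerDr.
apply: (le_trans (key _ _ (ltnW h) _)); first by lia.
by rewrite ler_wpM2l// lerDl.
Qed.

Lemma absz_divz_le (L : nat) e : (0 < L)%N ->
  ((absz e).+1 <= L * (absz (e %/ L%:Z)%Z).+1)%N.
Proof.
move=> L0.
have eE := divz_eq e L%:Z.
have r0 : 0 <= (e %% L%:Z)%Z by rewrite modz_ge0// gt_eqF.
have rL : (e %% L%:Z)%Z < L%:Z by rewrite ltz_mod// gt_eqF.
set q := (e %/ L%:Z)%Z in eE *; set t := (e %% L%:Z)%Z in eE r0 rL.
rewrite mulnS; have : absz (q * L%:Z) = (absz q * L)%N by rewrite abszM.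
case: (leP 0 q) => q0.
  have : 0 <= q * L%:Z by rewrite mulr_ge0.
  lia.
have : q * L%:Z <= - L%:Z by rewrite -mulN1r ler_wpM2r//; lia.
lia.
Qed.

Lemma weight_dilate r (L : nat) e : 0 <= r -> (0 < L)%N ->
  weight r e <= L%:R `^ r * weight r (e %/ L%:Z)%Z.
Proof.
move=> r0 L0; apply: le_powR_scale; rewrite ?addr_ge0//.
rewrite -!(natrD _ 1%N) -natrM ler_nat; exact: absz_divz_le.
Qed.

Lemma weight_shift r e : 0 <= r -> weight r e <= 2 `^ r * weight r (e + 1).
Proof.
move=> r0; apply: le_powR_scale; rewrite ?addr_ge0//.
rewrite -!(natrD _ 1%N) -natrM ler_nat; lia.
Qed.

Lemma weight_far r (L : nat) d e : 0 <= r -> (0 < L)%N -> (3 <= absz d)%N ->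
  (absz (e - d * L%:Z)%R < 2 * L)%N ->
  weight r d <= 4 `^ r * L%:R `^ (- r) * weight r e.
Proof.
move=> r0 L0 d3 ed; have [_ h _] := far_index d3 ed.
have L0' : 0 < L%:R :> R by rewrite ltr0n.
rewrite mulrAC powRN ler_pdivlMr ?powR_gt0// /weight -!powRM ?addr_ge0//.
rewrite ge0_ler_powR ?nnegrE ?mulr_ge0 ?addr_ge0//.
by rewrite -!(natrD _ 1%N) -!natrM ler_nat.
Qed.

Local Open Scope ereal_scope.

Definition wgt r (u : int -> \bar R) d : \bar R := u d * (weight r d)%:E.

Lemma wgt_ge0 r u : (forall d, 0 <= u d) -> forall d, 0 <= wgt r u d.
Proof. by move=> u0 d; rewrite mule_ge0// lee_fin. Qed.

(** The weight can be moved onto one of the two factors, at the price of a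
    constant; this gives the clause [decay_conv] for both norms. *)
Lemma wgt_conv r v g d : (0 <= r)%R ->
  (forall d, 0 <= v d) -> (forall d, 0 <= g d) ->
  wgt r (conv v g) d <=
  (2 `^ r)%:E * (conv (wgt r v) g d + conv v (wgt r g) d).
Proof.
move=> r0 v0 g0; have P2 : (0 <= 2 `^ r :> R)%R by exact: powR_ge0.
have wv0 := wgt_ge0 r v0; have wg0 := wgt_ge0 r g0.
have vg0 m : 0 <= v m * g (d - m)%R by rewrite mule_ge0.
rewrite /wgt muleC /conv -esumZ// -esumD; first last.
- by move=> m _; rewrite mule_ge0// wgt_ge0.
- by move=> m _; rewrite mule_ge0// wgt_ge0.
rewrite -esumZ//; last first.
  by move=> m; rewrite adde_ge0// mule_ge0//; apply: wgt_ge0.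
apply: le_esum => m _.
have -> : v m * (weight r m)%:E * g (d - m)%R =
    (weight r m)%:E * (v m * g (d - m)%R) by rewrite (muleC (v m)) muleA.
have -> : v m * (g (d - m)%R * (weight r (d - m))%:E) =
    (weight r (d - m))%:E * (v m * g (d - m)%R) by rewrite muleA muleC.
rewrite -ge0_muleDl ?lee_fin// [leRHS]muleA -(EFinD (weight r m)) -(EFinM (2 `^ r)).
by rewrite lee_wpmul2r// lee_fin weight_conv.
Qed.

(** Each value [F k] is taken at most [c] times. *)
Lemma esum_fiber (T1 T2 : choiceType) (A : set T1) (h : T1 -> T2)
    (F : T2 -> \bar R) (c : nat) : (forall k, 0 <= F k) ->
  (forall k, exists2 s : seq T1, (size s <= c)%N &
     forall i, A i -> h i = k -> i \in s) ->
  \esum_(i in A) F (h i) <= c%:R%:E * \esum_(k in [set: T2]) F k.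
Proof.
move=> F0 fib.
have step i : F (h i) <= \esum_(k in [set: T2]) if k \in [set h i] then F k else 0.
  by rewrite -esum_mkcond esum_set1.
apply: (le_trans (le_esum (fun i _ => step i))).
rewrite exchange_esum; last by move=> i k; case: ifP.
rewrite -esumZ//; apply: le_esum => k _.
have [s sc sP] := fib k.
rewrite (_ : \esum_(_ in _) _ = \esum_(i in A `&` [set i | h i = k]) F k); last first.
  rewrite esum_mkcondr; apply: eq_esum => i _.
  by congr (if _ then _ else _); apply/idP/idP; rewrite !inE /= => ->.
apply: (@le_trans _ _ ((size s)%:R%:E * F k)).
  by apply: esum_cover => // i [Ai] /=; exact: sP.
by rewrite lee_wpmul2r// lee_fin ler_nat.
Qed.

Lemma esum_divz (L : nat) (F : int -> \bar R) : (0 < L)%N -> (forall q, 0 <= F q) ->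
  \esum_(e in [set: int]) F (e %/ L%:Z)%Z <=
  L%:R%:E * \esum_(q in [set: int]) F q.
Proof.
move=> L0 F0; apply: esum_fiber => // q.
exists [seq (q * L%:Z + t%:Z)%R | t <- iota 0 L].
  by rewrite size_map size_iota.
move=> e _ <-; apply/mapP; exists (absz (e %% L%:Z)%Z).
  have r0 : (0 <= (e %% L%:Z)%Z)%R by rewrite modz_ge0// gt_eqF.
  have rL : ((e %% L%:Z)%Z < L%:Z)%R by rewrite ltz_mod// gt_eqF.
  by rewrite mem_iota; lia.
by rewrite gez0_abs -?divz_eq// modz_ge0// gt_eqF.
Qed.

Definition decay_l1 r (u : int -> \bar R) : \bar R :=
  \esum_(d in [set: int]) wgt r u d.

Definition decay_sup r (u : int -> \bar R) : \bar R :=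
  ereal_sup [set wgt r u d | d in [set: int]].

Lemma le_wgt r f g : (forall d, f d <= g d) -> forall d, wgt r f d <= wgt r g d.
Proof. by move=> fg d; rewrite lee_wpmul2r// lee_fin. Qed.

Lemma wgt_near_le r d : (0 <= r)%R ->
  wgt r (fun d => if (absz d <= 2)%N then 1 else 0) d <=
  if (absz d <= 2)%N then (3 `^ r)%:E else 0.
Proof.
move=> r0; rewrite /wgt; case: ifP => d2; last by rewrite mul0e.
rewrite mul1e lee_fin ge0_ler_powR ?nnegrE ?addr_ge0//.
by rewrite -(natrD _ 1%N) ler_nat; lia.
Qed.

Lemma wgt_dilate r L u e : (0 <= r)%R -> (0 < L)%N -> (forall d, 0 <= u d) ->
  wgt r (fun e => u (e %/ L%:Z)%Z + u ((e %/ L%:Z)%Z + 1)%R) e <=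
  (L%:R `^ r)%:E * (wgt r u (e %/ L%:Z)%Z
     + (2 `^ r)%:E * wgt r u ((e %/ L%:Z)%Z + 1)%R).
Proof.
move=> r0 L0 u0; rewrite /wgt; set q := (e %/ L%:Z)%Z.
apply: (@le_trans _ _ ((u q + u (q + 1)%R) * (L%:R `^ r * weight r q)%:E)).
  by rewrite lee_wpmul2l ?adde_ge0// lee_fin weight_dilate.
rewrite EFinM muleCA; apply: lee_wpmul2l; first by rewrite lee_fin powR_ge0.
rewrite ge0_muleDl// leeD2l// muleCA lee_wpmul2l//.
by rewrite -EFinM lee_fin weight_shift.
Qed.

Lemma le_powR2 (x y r : R) : (0 <= r)%R -> (0 <= x)%R -> (x <= y)%R ->
  (x `^ r <= y `^ r)%R.
Proof.
by move=> r0 x0 xy; rewrite ge0_ler_powR ?nnegrE//; exact: le_trans xy.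
Qed.

(** Only the finite partial sums matter, and on a finite set a uniform error
    contributes arbitrarily little. *)
Lemma decay_l1_lim r b B : (forall e : R, (0 < e)%R -> exists h,
      [/\ forall d, 0 <= h d, decay_l1 r h <= B & forall d, b d <= h d + e%:E]) ->
    decay_l1 r b <= B.
Proof.
move=> lim; apply: ge_ereal_sup => _ [X [finX _] <-].
apply/lee_addgt0Pr => e e0.
pose W : R := (\sum_(d <- fset_set X) weight r d)%R.
have W0 : (0 <= W)%R by apply: sumr_ge0.
have W1 : (0 < W + 1)%R by rewrite ltr_wpDl.
have [|h [h0 hB bh]] := lim (e / (W + 1))%R; first by rewrite divr_gt0.
rewrite fsbig_finite//=.
apply: (@le_trans _ _ (\sum_(d <- fset_set X)
    (wgt r h d + ((e / (W + 1)) * weight r d)%:E))).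
  apply: lee_sum => d _; rewrite /wgt EFinM -ge0_muleDl//; last first.
    by rewrite lee_fin ltW// divr_gt0.
  by rewrite lee_wpmul2r// lee_fin.
rewrite big_split/= sumEFin -mulr_sumr -/W; apply: leeD.
  apply: le_trans hB; rewrite /decay_l1; apply: esum_ge; exists X => //.
  by rewrite fsbig_finite.
rewrite lee_fin mulrAC ler_pdivrMr// ler_wpM2l//; first exact: ltW.
by rewrite lerDl.
Qed.

Lemma decay_norm_l1 r : (0 < r)%R ->
  decay_norm r (20 * 4 `^ r) (decay_l1 r).
Proof.
move=> r0; have r0' := ltW r0; set D := (20 * _)%R.
have P1 : (1 <= 4 `^ r :> R)%R.
  by rewrite -[X in (X <= _)%R](powRr0 4) ler_powR//; lra.
have P2 : (2 `^ r <= 4 `^ r :> R)%R by apply: le_powR2 => //; lra.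
have P3 : (3 `^ r <= 4 `^ r :> R)%R by apply: le_powR2 => //; lra.
have P20 : (0 <= 2 `^ r :> R)%R by exact: powR_ge0.
have P30 : (0 <= 3 `^ r :> R)%R by exact: powR_ge0.
split => //.
- by rewrite /D; lra.
- by move=> f g fg; apply: le_esum => d _; apply: le_wgt.
- move=> f g f0 g0; rewrite /decay_l1 -esumD.
  + by apply: le_esum => d _; rewrite /wgt ge0_muleDl.
  + by move=> d _; exact: wgt_ge0.
  + by move=> d _; exact: wgt_ge0.
- move=> c g c0 g0; rewrite /decay_l1 -esumZ//; last exact: wgt_ge0.
  by apply: le_esum => d _; rewrite /wgt muleA.
- exact: decay_l1_lim.
- apply: (@le_trans _ _ (\esum_(d in [set d : int | (absz d <= 2)%N]) (3 `^ r)%:E)).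
    rewrite esum_mkcond; apply: le_esum => d _; apply: (le_trans (wgt_near_le _ _)) => //.
    case: ifPn => d2; first by rewrite ifT// inE.
    by rewrite ifF//; apply/negbTE; rewrite notin_setE /=; apply/negP.
  apply: (le_trans (@esum_cover _ _ _ [:: -2; -1; 0; 1; 2]%R _ _ _)) => //.
    by move=> d /=; rewrite !inE; lia.
  by rewrite /= -EFinM lee_fin /D; lra.
- move=> v g v0 g0.
  have wv0 := wgt_ge0 r v0; have wg0 := wgt_ge0 r g0.
  have c1 d : 0 <= conv (wgt r v) g d by exact: conv_ge0.
  have c2 d : 0 <= conv v (wgt r g) d by exact: conv_ge0.
  apply: (@le_trans _ _ (\esum_(d in [set: int])
      ((2 `^ r)%:E * (conv (wgt r v) g d + conv v (wgt r g) d)))).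
    by apply: le_esum => d _; exact: wgt_conv.
  rewrite esumZ//; last by move=> d; rewrite adde_ge0.
  rewrite esumD//; apply: lee_pmul.
  + by rewrite lee_fin.
  + by rewrite adde_ge0// esum_ge0.
  + by rewrite lee_fin /D; lra.
  + by rewrite addeC leeD// esum_conv_le.
- move=> n u n0 u0.
  have wu0 := wgt_ge0 r u0.
  have n0' : (0 < n%:R :> R)%R by rewrite ltr0n.
  have N0 : (0 <= n%:R `^ (- r) :> R)%R by exact: powR_ge0.
  apply: (@le_trans _ _ ((n%:R `^ (- r))%:E * decay_l1 r u)); last first.
    rewrite lee_wpmul2r ?esum_ge0// lee_fin ler_peMl// /D; lra.
  rewrite -esumZ// /tail esum_mkcond; apply: le_esum => d _.
  case: ifPn => [|_]; last by rewrite mule_ge0// wgt_ge0.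
  rewrite inE /= => nd; rewrite /wgt muleCA -[leLHS]mule1 lee_wpmul2l//.
  rewrite -EFinM lee_fin powRN mulrC ler_pdivlMr ?powR_gt0// mul1r.
  by rewrite le_powR2// -(natrD _ 1%N) ler_nat.
- move=> L u L0 u0.
  have wu0 := wgt_ge0 r u0.
  have L0' : (0 < L%:R :> R)%R by rewrite ltr0n.
  have N0 : (0 <= L%:R `^ (- r) :> R)%R by exact: powR_ge0.
  have c0 : (0 <= 4 `^ r * L%:R `^ (- r) :> R)%R by rewrite mulr_ge0//; lra.
  have := @esum_far_le R L u (weight r)
    (fun e => (4 `^ r * L%:R `^ (- r) * weight r e)%:E) u0.
  move=> /(_ (weight_ge0 r) _ _)/le_trans; apply.
  + by move=> d; rewrite lee_fin mulr_ge0.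
  + by move=> d e d3 ed; rewrite lee_fin weight_far.
  apply: (@le_trans _ _ (4%:E * ((4 `^ r * L%:R `^ (- r))%:E * decay_l1 r u))).
    apply: lee_wpmul2l => //; rewrite -esumZ// esum_mkcond.
    apply: le_esum => e _; case: ifPn => _; last by rewrite mule_ge0// lee_fin.
    by rewrite EFinM muleCA.
  rewrite muleA -EFinM lee_wpmul2r ?esum_ge0// lee_fin /D mulrA ler_wpM2r//; lra.
- move=> L u L0 u0.
  have wu0 := wgt_ge0 r u0.
  have L0' : (0 < L%:R :> R)%R by rewrite ltr0n.
  have N0 : (0 <= L%:R `^ r :> R)%R by exact: powR_ge0.
  pose F q := wgt r u q + (2 `^ r)%:E * wgt r u (q + 1)%R.
  have F0 q : 0 <= F q by rewrite adde_ge0// mule_ge0.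
  have DE : (L%:R `^ (r + 1) = L%:R `^ r * L%:R :> R)%R.
    by rewrite powRD ?powRr1 ?(ltW L0')// (gt_eqF L0') implybT.
  apply: (@le_trans _ _ ((L%:R `^ r)%:E * (L%:R%:E * \esum_(q in [set: int]) F q))).
    apply: (@le_trans _ _ ((L%:R `^ r)%:E * \esum_(e in [set: int]) F (e %/ L%:Z)%Z)).
      by rewrite -esumZ//; apply: le_esum => e _; exact: wgt_dilate.
    by rewrite lee_wpmul2l//; exact: esum_divz.
  apply: (@le_trans _ _ ((L%:R `^ r)%:E * (L%:R%:E * ((1 + 2 `^ r)%:E * decay_l1 r u)))).
    rewrite !lee_wpmul2l ?lee_fin// /F esumD//; last by move=> d _; rewrite mule_ge0.
    rewrite esumZ// (@esum_setT_bij _ (fun q => q + 1)%R (fun q => q - 1)%R).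
    - rewrite EFinD ge0_muleDl ?lee_fin// mul1e; exact: lexx.
    - by move=> q; rewrite addrK.
    - by move=> q; rewrite subrK.
  rewrite !muleA -!EFinM lee_wpmul2r ?esum_ge0// lee_fin DE mulrC.
  by rewrite ler_wpM2r ?mulr_ge0// /D; lra.
Qed.

Lemma powR_ge1D_ln (x y : R) : (0 < x)%R -> (1 + y * ln x <= x `^ y)%R.
Proof. by move=> x0; rewrite /powR gt_eqF// expR_ge1Dx. Qed.

(** Integral comparison without integrals: since
    [((k + 1) / k)^s >= 1 + s ln ((k + 1) / k) >= 1 + s / (k + 1)], the
    decrement of [k^(-s)] is at least [s (k + 1)^(- s - 1)]. *)
Lemma powR_telescope (s k : R) : (0 < s)%R -> (1 <= k)%R ->
  (k `^ (- (s + 1)) <= 2 `^ (s + 1) / s * (k `^ (- s) - (k + 1) `^ (- s)))%R.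
Proof.
move=> s0 k1.
have k0 : (0 < k)%R by lra.
have k10 : (0 < k + 1)%R by lra.
have s10 : (0 <= s + 1)%R by lra.
set x := ((k + 1) / k)%R.
have x0 : (0 < x)%R by rewrite divr_gt0.
have lnx : ((k + 1)^-1 <= ln x)%R.
  have -> : x = (k / (k + 1))^-1%R by rewrite invf_div.
  rewrite lnV ?posrE ?divr_gt0// lerNr.
  have -> : (k / (k + 1) = 1 + - (k + 1)^-1)%R by field; rewrite gt_eqF.
  apply: le_ln1Dx; rewrite ltrN2 invf_lt1//; lra.
have xs : ((s / (k + 1)) <= x `^ s - 1)%R.
  have := powR_ge1D_ln s x0.
  have : (s / (k + 1) <= s * ln x)%R by rewrite ler_wpM2l// ltW.
  lra.
have kE : (k `^ (- s) - (k + 1) `^ (- s) = (k + 1) `^ (- s) * (x `^ s - 1))%R.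
  rewrite /x powRM ?invr_ge0 ?ltW// -(powR_inv1 (ltW k0)) -powRrM mulN1r.
  rewrite mulrBr mulr1 mulrA -powRD ?addNr ?powRr0 ?mul1r//.
  by rewrite (gt_eqF k10) implybT.
rewrite kE.
have -> : (2 `^ (s + 1) / s * ((k + 1) `^ (- s) * (x `^ s - 1)) =
   2 `^ (s + 1) * (k + 1) `^ (- s) / s * (x `^ s - 1))%R by ring.
apply: (@le_trans _ _ (2 `^ (s + 1) * (k + 1) `^ (- s) / s * (s / (k + 1)))%R); last first.
  by rewrite ler_wpM2l// divr_ge0 ?mulr_ge0 ?powR_ge0 ?ltW.
have -> : (2 `^ (s + 1) * (k + 1) `^ (- s) / s * (s / (k + 1)) =
   2 `^ (s + 1) * ((k + 1) `^ (- s) / (k + 1)))%R by field; rewrite !gt_eqF.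
have -> : ((k + 1) `^ (- s) / (k + 1) = ((k + 1) `^ (s + 1))^-1)%R.
  rewrite -powRN opprD powRD ?(gt_eqF k10) ?implybT//.
  by rewrite powR_inv1// ltW.
rewrite powRN ler_pdivlMr ?powR_gt0// mulrC ler_pdivrMr ?powR_gt0//.
rewrite -powRM ?(ltW k0)//; apply: le_powR2 => //; lra.
Qed.

Lemma esum_powR_tail (s : R) (n : nat) : (0 < s)%R -> (0 < n)%N ->
  \esum_(j in [set: nat]) ((n + j)%:R `^ (- (s + 1)))%:E <=
  (2 `^ (s + 1) / s * n%:R `^ (- s))%:E.
Proof.
move=> s0 n0; set c := (2 `^ (s + 1) / s)%R.
have c0 : (0 <= c)%R by rewrite divr_ge0 ?powR_ge0 ?ltW.
have part N : (\sum_(0 <= j < N) (n + j)%:R `^ (- (s + 1)) <=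
    c * (n%:R `^ (- s) - (n + N)%:R `^ (- s)))%R.
  elim: N => [|N IH]; first by rewrite big_nil addn0 subrr mulr0.
  rewrite big_nat_recr//=.
  have : (1 <= (n + N)%:R :> R)%R by rewrite ler1n; lia.
  move=> /(powR_telescope s0); rewrite -/c -(natrD _ _ 1%N) addn1 -addnS.
  move: IH; rewrite !mulrBr; lra.
rewrite -nneseries_esumT; last by move=> j; rewrite lee_fin powR_ge0.
apply: lime_le; first by apply: is_cvg_nneseries => j _ _; rewrite lee_fin powR_ge0.
apply: nearW => N; rewrite sumEFin lee_fin; apply: (le_trans (part N)).
by rewrite ler_wpM2l// gerBl powR_ge0.
Qed.

Lemma tail_weight (s : R) (n : nat) : (0 < s)%R -> (0 < n)%N ->
  tail n (fun d => ((weight (s + 1) d)^-1)%:E) <=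
  (2 * (2 `^ (s + 1) / s) * n%:R `^ (- s))%:E.
Proof.
move=> s0 n0.
pose F j : \bar R := ((n + j)%:R `^ (- (s + 1)))%:E.
apply: (@le_trans _ _ (\esum_(e in [set e : int | (n <= (absz e).+1)%N])
    F ((absz e).+1 - n)%N)).
  apply: le_esum => e /= ne; rewrite /F subnKC// /weight -powRN lee_fin.
  by rewrite -(natrD _ 1%N) add1n.
apply: (le_trans (@esum_fiber _ _ _ (fun e : int => ((absz e).+1 - n)%N) F 2 _ _)).
- by move=> k; rewrite lee_fin powR_ge0.
- move=> k; exists [:: (n + k)%:Z - 1; 1 - (n + k)%:Z]%R => //.
  by move=> e /= ne <-; rewrite !inE; lia.
rewrite -mulrA EFinM lee_wpmul2l//; exact: esum_powR_tail.
Qed.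

(** Passing from a supremum to a sum loses one power of the distance, whence
    the exponent [s + 1] of the weight for decay of order [s]. *)
Lemma decay_norm_sup (s : R) : (0 < s)%R ->
  decay_norm s (20 * 4 `^ (s + 1) + 2 * (2 `^ (s + 1) / s)) (decay_sup (s + 1)).
Proof.
move=> s0; set r := (s + 1)%R; have r0 : (0 <= r)%R by rewrite /r; lra.
set T := (2 * (_ / s))%R; set D := (20 * _ + _)%R.
have T0 : (0 <= T)%R by rewrite !mulr_ge0 ?powR_ge0 ?invr_ge0// ltW.
have P1 : (1 <= 4 `^ r :> R)%R.
  by rewrite -[X in (X <= _)%R](powRr0 4) ler_powR//; lra.
have P2 : (2 `^ r <= 4 `^ r :> R)%R by apply: le_powR2 => //; lra.
have P3 : (3 `^ r <= 4 `^ r :> R)%R by apply: le_powR2 => //; lra.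
have P20 : (0 <= 2 `^ r :> R)%R by exact: powR_ge0.
have P30 : (0 <= 3 `^ r :> R)%R by exact: powR_ge0.
have ub u d : wgt r u d <= decay_sup r u by apply: ereal_sup_ubound; exists d.
have p0 u : (forall d, 0 <= u d) -> 0 <= decay_sup r u.
  by move=> u0; apply: le_trans (ub u 0%R); apply: wgt_ge0.
have lub u (B : \bar R) : (forall d, wgt r u d <= B) -> decay_sup r u <= B.
  by move=> uB; apply: ge_ereal_sup => _ [d _ <-].
have usup u d : (forall d, 0 <= u d) -> u d <= decay_sup r u * ((weight r d)^-1)%:E.
  by move=> u0; rewrite lee_pdivlMr ?weight_gt0//; exact: ub.
split => //.
- by rewrite /D; lra.
- by move=> f g fg; apply: lub => d; apply: (le_trans (le_wgt r fg d)).
- move=> f g f0 g0; apply: lub => d; rewrite /wgt ge0_muleDl//.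
  by apply: leeD; exact: ub.
- move=> c g c0 g0; apply: lub => d; rewrite /wgt -muleA lee_wpmul2l//.
  exact: ub.
- move=> b B lim; apply: lub => d; apply/lee_addgt0Pr => e e0.
  have [|h [h0 hB bh]] := lim (e / weight r d)%R.
    by rewrite divr_gt0// weight_gt0.
  apply: (@le_trans _ _ ((h d + (e / weight r d)%:E) * (weight r d)%:E)).
    by rewrite lee_wpmul2r// lee_fin weight_ge0.
  rewrite ge0_muleDl//; last by rewrite lee_fin divr_ge0// ?weight_ge0// ltW.
  rewrite -EFinM divfK ?gt_eqF ?weight_gt0// leeD2r//.
  by apply: le_trans hB; exact: ub.
- apply: lub => d; apply: (le_trans (wgt_near_le _ _)) => //.
  by case: ifP => _; rewrite lee_fin /D; lra.
- move=> v g v0 g0.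
  have wv0 := wgt_ge0 r v0; have wg0 := wgt_ge0 r g0.
  have cle x y d : (forall d, 0 <= x d) -> (forall d, 0 <= y d) ->
      conv x (wgt r y) d <= (\esum_(d in [set: int]) x d) * decay_sup r y.
    move=> x0 y0; apply: (@le_trans _ _ (conv x (fun=> decay_sup r y) d)).
      by apply: le_conv => // e; exact: ub.
    by rewrite muleC conv_cst_le// p0.
  apply: lub => d; apply: (le_trans (wgt_conv _ _ _ _)) => //.
  apply: lee_pmul.
  + by rewrite lee_fin.
  + by rewrite adde_ge0//; apply: conv_ge0.
  + by rewrite lee_fin /D; lra.
  + by rewrite addeC; apply: leeD; [exact: cle|rewrite convC muleC; exact: cle].
- move=> n u n0 u0.
  have N0 : (0 <= n%:R `^ (- s) :> R)%R by exact: powR_ge0.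
  apply: (@le_trans _ _ (tail n (fun d => decay_sup r u * ((weight r d)^-1)%:E))).
    by apply: le_esum => d _; exact: usup.
  rewrite /tail; apply: (le_trans (esumZ_le _ _ _)).
  + exact: p0.
  + by move=> d; rewrite lee_fin invr_ge0 weight_ge0.
  rewrite muleC lee_wpmul2r ?p0//; apply: (le_trans (tail_weight s0 n0)).
  by rewrite lee_fin ler_wpM2r// /D /T; lra.
- move=> L u L0 u0.
  have L0' : (0 < L%:R :> R)%R by rewrite ltr0n.
  have N0 : (0 <= L%:R `^ (- r) :> R)%R by exact: powR_ge0.
  have c0 : (0 <= 4 `^ r * L%:R `^ (- r) :> R)%R by rewrite mulr_ge0//; lra.
  have DE : (4 * L%:R * (4 `^ r * L%:R `^ (- r)) = 4 * 4 `^ r * L%:R `^ (- s) :> R)%R.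
    have -> : (L%:R `^ (- r) = L%:R `^ (- s) / L%:R :> R)%R.
      by rewrite /r opprD powRD ?(gt_eqF L0') ?implybT// powR_inv1// ltW.
    by field; rewrite gt_eqF.
  apply: lub => d; rewrite /wgt /far; case: ifPn => [d3|_]; last first.
    by rewrite mul0e mule_ge0 ?p0// lee_fin mulr_ge0 ?powR_ge0// /D; lra.
  rewrite muleC -esumZ ?weight_ge0//.
  set S := [set e : int | _].
  apply: (@le_trans _ _ (\esum_(e in S)
      ((4 `^ r * L%:R `^ (- r))%:E * decay_sup r u))).
    apply: le_esum => e ed; apply: (@le_trans _ _
      ((4 `^ r * L%:R `^ (- r) * weight r e)%:E * u e)).
      by rewrite lee_wpmul2r// lee_fin weight_far.
    rewrite EFinM -muleA lee_wpmul2l ?lee_fin// muleC; exact: ub.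
  pose sq := [seq (d * L%:Z - 2 * L%:Z + t%:Z)%R | t <- iota 0 (4 * L)].
  apply: (le_trans (@esum_cover _ _ S sq _ _ _)).
  + by rewrite mule_ge0 ?p0.
  + move=> e; rewrite /S /= => ed; apply/mapP.
    exists (absz (e - d * L%:Z + 2 * L%:Z)%R); last by lia.
    by rewrite mem_iota; lia.
  rewrite /sq size_map size_iota natrM muleA -EFinM DE lee_wpmul2r ?p0//.
  by rewrite lee_fin ler_wpM2r ?powR_ge0// /D; lra.
- move=> L u L0 u0.
  have N0 : (0 <= L%:R `^ r :> R)%R by exact: powR_ge0.
  have wu0 := wgt_ge0 r u0.
  apply: lub => e; apply: (le_trans (wgt_dilate _ _ _ _)) => //.
  apply: (@le_trans _ _ ((L%:R `^ r)%:E * ((1 + 2 `^ r)%:E * decay_sup r u))).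
    rewrite lee_wpmul2l// EFinD ge0_muleDl ?lee_fin// mul1e.
    by apply: leeD; rewrite ?lee_wpmul2l.
  rewrite muleA -EFinM lee_wpmul2r ?p0// lee_fin mulrC ler_wpM2r// /D; lra.
Qed.

End weights.

(** * Operators on square-summable sequences *)

Import ComplexField Normc.
Local Open Scope complex_scope.
Local Open Scope ring_scope.

Section ell2_theory.
Variable R : realType.
Local Notation C := R[i].
Local Notation ell2 := (ell2 R).
Implicit Types (x y : ell2) (f g : int -> C).

Lemma ell2P x y : (forall k, x k = y k) -> x = y.
Proof. by move=> xy; apply/val_inj/funext. Qed.

Lemma ell2D x y k : (x + y) k = x k + y k. Proof. by []. Qed.

Lemma ell2B x y k : (x - y) k = x k - y k. Proof. by []. Qed.

Lemma ell2_sum (I : Type) (r : seq I) (F : I -> ell2) k :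
  (\sum_(i <- r) F i) k = \sum_(i <- r) F i k.
Proof.
elim: r => [|i r IH]; first by rewrite !big_nil.
by rewrite !big_cons ell2D IH.
Qed.

Lemma normc_real (a : R) : normc a%:C = `|a|.
Proof. by rewrite /normc /= expr0n addr0 sqrtr_sqr. Qed.

Lemma normc_sum_le (I : Type) (r : seq I) (F : I -> C) :
  normc (\sum_(i <- r) F i) <= \sum_(i <- r) normc (F i).
Proof.
elim: r => [|i r IH]; first by rewrite !big_nil normc0.
by rewrite !big_cons (le_trans (le_normcD _ _))// lerD2l.
Qed.

Lemma l2norm_le (x y : ell2) (t : R) : 0 <= t ->
  (l2sq x <= (t ^+ 2)%:E * l2sq y)%E -> l2norm x <= t * l2norm y.
Proof.
move=> t0; rewrite !l2sqE -EFinM lee_fin -exprMn => h.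
by rewrite -(@ler_pXn2r _ 2)// nnegrE ?mulr_ge0 ?l2norm_ge0.
Qed.

Lemma l2norm_eq0 x : l2norm x = 0 -> x = 0.
Proof.
move=> x0; apply: ell2P => k; apply: eq0_normc; apply/eqP.
by rewrite eq_le normc_ge0 andbT -x0 normc_le_l2norm.
Qed.

(** Pointwise, [2 |f g| <= t |f|^2 + |g|^2 / t]; the triangle inequality
    results from the choice [t = |g| / |f|]. *)
Lemma l2sqD_weighted f g (t : R) : 0 < t ->
  (l2sq (f + g)%R <= (1 + t)%:E * l2sq f + (1 + t^-1)%:E * l2sq g)%E.
Proof.
move=> t0; have ti : 0 < t^-1 by rewrite invr_gt0.
have t1 : 0 <= 1 + t by lra.
have t2 : 0 <= 1 + t^-1 by lra.
rewrite /l2sq -!esumZ//; do ?by move=> k; rewrite lee_fin sqr_ge0.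
rewrite -esumD; do ?by move=> k _; rewrite -EFinM lee_fin mulr_ge0 ?sqr_ge0.
apply: le_esum => k _; rewrite -!EFinM -EFinD lee_fin fctE.
have h := le_normcD (f k) (g k).
have a0 := normc_ge0 (f k); have b0 := normc_ge0 (g k).
apply: (@le_trans _ _ ((normc (f k) + normc (g k)) ^+ 2)).
  by rewrite lerXn2r// nnegrE ?normc_ge0 ?addr_ge0.
move: (normc (f k)) (normc (g k)) a0 b0 => a b a0 b0 {h}.
rewrite -subr_ge0.
have -> : (1 + t) * a ^+ 2 + (1 + t^-1) * b ^+ 2 - (a + b) ^+ 2 =
  t * (a - t^-1 * b) ^+ 2 by field; rewrite gt_eqF.
by rewrite mulr_ge0 ?sqr_ge0// ltW.
Qed.

Lemma l2normD x y : l2norm (x + y) <= l2norm x + l2norm y.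
Proof.
have [x0|x0] := eqVneq (l2norm x) 0.
  by rewrite x0 (l2norm_eq0 x0) !add0r.
have [y0|y0] := eqVneq (l2norm y) 0.
  by rewrite y0 (l2norm_eq0 y0) !addr0.
have X0 : 0 < l2norm x by rewrite lt_def x0 l2norm_ge0.
have Y0 : 0 < l2norm y by rewrite lt_def y0 l2norm_ge0.
rewrite -(@ler_pXn2r _ 2)// ?nnegrE ?addr_ge0 ?l2norm_ge0//.
have := @l2sqD_weighted x y (l2norm y / l2norm x) (divr_gt0 Y0 X0).
rewrite -[X in (l2sq X <= _)%E]/(ell2_val (x + y)) !l2sqE.
rewrite -(EFinM (1 + _)) -(EFinM (1 + _^-1)) -EFinD lee_fin => /le_trans; apply.
rewrite le_eqVlt; apply/orP; left; apply/eqP.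
by field; rewrite x0 y0.
Qed.

Lemma l2normN x : l2norm (- x) = l2norm x.
Proof. by rewrite -scaleN1r l2normZ normcN normc1 mul1r. Qed.

Lemma l2norm_sum (I : Type) (r : seq I) (F : I -> ell2) :
  l2norm (\sum_(i <- r) F i) <= \sum_(i <- r) l2norm (F i).
Proof.
elim: r => [|i r IH]; first by rewrite !big_nil l2norm0.
by rewrite !big_cons (le_trans (l2normD _ _))// lerD2l.
Qed.

Definition contractive (c : int -> R) := forall k, 0 <= c k <= 1.

(** Multiplication by [c].  The default value [0] is never met for
    contractive [c], the only case used. *)
Definition cut (c : int -> R) x : ell2 := insubd 0 (fun k => (c k)%:C * x k).

Lemma normc_cut_le (c : int -> R) (z : C) k :
  contractive c -> normc ((c k)%:C * z) <= normc z.
Proof.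
move=> /(_ k)/andP[c0 c1]; rewrite normcM normc_real ger0_norm//.
by rewrite ler_piMl ?normc_ge0.
Qed.

Lemma cutE c x k : contractive c -> cut c x k = (c k)%:C * x k.
Proof.
move=> cc; rewrite /cut -[X in X k]/(val _) insubdK// inE.
apply: le_lt_trans (_ : (l2sq x < +oo)%E); last by rewrite l2sqE ltry.
apply: le_esum => j _; rewrite lee_fin lerXn2r// ?nnegrE ?normc_ge0//.
exact: normc_cut_le.
Qed.

Lemma l2norm_cut c x : contractive c -> l2norm (cut c x) <= l2norm x.
Proof.
move=> cc; rewrite -[leRHS]mul1r; apply: l2norm_le => //.
rewrite expr1n mul1e; apply: le_esum => j _.
rewrite lee_fin lerXn2r// ?nnegrE ?normc_ge0// cutE//.
exact: normc_cut_le.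
Qed.

Definition restr (S : pred int) x : ell2 := cut (fun k => (S k)%:R) x.

Lemma contractive_ind (S : pred int) : contractive (fun k => (S k)%:R).
Proof. by move=> k; case: (S k); rewrite ?lexx ?ler01. Qed.
Hint Resolve contractive_ind : core.

Lemma restrE S x k : restr S x k = if S k then x k else 0.
Proof. by rewrite cutE//; case: (S k); rewrite ?mul1r ?mul0r. Qed.

Lemma l2norm_restr S x : l2norm (restr S x) <= l2norm x.
Proof. exact: l2norm_cut. Qed.

Lemma sum_le_l2sq f (s : seq int) : uniq s ->
  (\sum_(j <- s) ((normc (f j) ^+ 2)%:E) <= l2sq f)%E.
Proof.
move=> us; rewrite fsbig_seq//; apply: esum_ge; exists [set` s] => //.
by split => //; exact: finite_seq.

Qed.

Lemma l2norm_restrC S x :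
  l2norm (restr S x) ^+ 2 + l2norm (x - restr S x) ^+ 2 = l2norm x ^+ 2.
Proof.
apply: EFin_inj; rewrite EFinD -!l2sqE /l2sq -esumD.
- apply: eq_esum => k _; rewrite ell2B restrE.
  by case: (S k); rewrite ?subrr ?subr0 normc0 expr0n ?adde0 ?add0e.
- by move=> k _; rewrite lee_fin sqr_ge0.
- by move=> k _; rewrite lee_fin sqr_ge0.
Qed.

(** Finitely supported vectors are dense, in the form that any restriction to
    a large enough set is close to [x]. *)
Lemma ell2_tail x (e : R) : 0 < e -> exists s : seq int,
  forall S : pred int, (forall k, k \in s -> S k) -> l2norm (x - restr S x) <= e.
Proof.
move=> e0.
have : (l2sq x - (e ^+ 2)%:E < l2sq x)%E.
  by rewrite l2sqE -EFinB lte_fin gtrDl oppr_lt0 exprn_gt0.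
move=> /ereal_sup_gt[_ [F [finF _] <-]] xF.
exists (fset_set F) => S FS.
rewrite -(@ler_pXn2r _ 2)// ?nnegrE ?l2norm_ge0 ?(ltW e0)//.
have := l2norm_restrC S x.
suff : l2norm x ^+ 2 - e ^+ 2 <= l2norm (restr S x) ^+ 2 by lra.
rewrite -lee_fin EFinB -!l2sqE; apply: (le_trans (ltW xF)).
rewrite fsbig_finite//=.
rewrite (eq_big_seq (fun j => (normc (restr S x j) ^+ 2)%:E)); last first.
  by move=> j jF; rewrite restrE FS.
by apply: sum_le_l2sq; exact: fset_uniq.
Qed.

Lemma cauchy_schwarz_weighted (I : Type) (s : seq I) (k t : I -> R) :
  (forall i, 0 <= k i) -> (forall i, 0 <= t i) ->
  (\sum_(i <- s) k i * t i) ^+ 2 <=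
  (\sum_(i <- s) k i) * \sum_(i <- s) k i * t i ^+ 2.
Proof.
move=> k0 t0; elim: s => [|i s]; first by rewrite !big_nil mul0r expr0n.
rewrite !big_cons.
have : 0 <= \sum_(i <- s) k i by apply: sumr_ge0.
have : 0 <= \sum_(i <- s) k i * t i ^+ 2.
  by apply: sumr_ge0 => j _; rewrite mulr_ge0// exprn_ge0.
have : 0 <= \sum_(i <- s) k i * t i by apply: sumr_ge0 => j _; rewrite mulr_ge0.
move: (\sum_(i <- s) k i) (\sum_(i <- s) k i * t i) (\sum_(i <- s) k i * t i ^+ 2).
move=> K S Q S0 Q0 K0 h.
have {}k0 := k0 i; have {}t0 := t0 i; move: (k i) (t i) k0 t0 => a u a0 u0.
suff : 0 <= Q - 2 * S * u + K * u ^+ 2.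
  move=> /(mulr_ge0 a0); move: h; nra.
have [K00|Kn] := eqVneq K 0.
  have : S = 0 by apply/eqP; rewrite -sqrf_eq0 eq_le sqr_ge0 andbT -(mul0r Q) -K00.
  by move=> ->; rewrite K00; lra.
have Kp : 0 < K by rewrite lt_def Kn.
rewrite -(pmulr_rge0 _ Kp).
apply: le_trans (sqr_ge0 (S - K * u)) _; nra.
Qed.

(** Schur's test: entries dominated by a summable function of [i - j] define
    an operator of norm at most the sum, by the weighted Cauchy-Schwarz
    inequality along rows and summation along columns. *)
Lemma schur_bound f x (k : int -> R) (s : seq int) (t : R) :
  (forall e, 0 <= k e) -> (\esum_(e in [set: int]) (k e)%:E <= t%:E)%E ->
  uniq s ->
  (forall i, normc (f i) <= \sum_(j <- s) k (i - j) * normc (x j)) ->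
  (l2sq f <= (t ^+ 2)%:E * l2sq x)%E.
Proof.
move=> k0 kt us fk.
have t0 : 0 <= t by rewrite -lee_fin; apply: le_trans kt; apply: esum_ge0 => e _; rewrite lee_fin.
have rowsum i : \sum_(j <- s) k (i - j) <= t.
  rewrite -lee_fin; apply: le_trans kt.
  rewrite -(@esum_setT_bij R (fun j => i - j) (fun j => i - j) (fun e => (k e)%:E)).
  - rewrite -sumEFin fsbig_seq//; apply: esum_ge; exists [set` s] => //.
    by split => //; exact: finite_seq.
  - by move=> j; rewrite opprB addrC subrK.
  - by move=> j; rewrite opprB addrC subrK.
apply: (@le_trans _ _ (\esum_(i in [set: int])
    (t%:E * \sum_(j <- s) ((k (i - j) * normc (x j) ^+ 2)%:E))))%E.
  apply: le_esum => i _; rewrite sumEFin -EFinM lee_fin.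
  apply: (@le_trans _ _ ((\sum_(j <- s) k (i - j) * normc (x j)) ^+ 2)).
    rewrite lerXn2r// nnegrE ?normc_ge0// sumr_ge0// => j _.
    by rewrite mulr_ge0// normc_ge0.
  apply: (le_trans (cauchy_schwarz_weighted _ _ _)) => // [j|].
    exact: normc_ge0.
  rewrite ler_wpM2r// sumr_ge0// => j _.
  by rewrite mulr_ge0// sqr_ge0.
have kx i j : (0 <= (k (i - j) * normc (x j) ^+ 2)%:E)%E.
  by rewrite lee_fin mulr_ge0 ?sqr_ge0.
rewrite esumZ//; last by move=> i; apply: sume_ge0.
rewrite exprS expr1 EFinM -muleA lee_wpmul2l//.
rewrite esum_sum//.
apply: (@le_trans _ _ (\sum_(j <- s) (t%:E * (normc (x j) ^+ 2)%:E)))%E.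
  apply: lee_sum => j _.
  under eq_esum do rewrite mulrC EFinM.
  rewrite esumZ ?sqr_ge0//; last by move=> i; rewrite lee_fin.
  rewrite muleC lee_wpmul2r ?lee_fin ?sqr_ge0//.
  rewrite (@esum_setT_bij R (fun i => i - j) (fun i => i + j) (fun e => (k e)%:E))//.
  - by move=> i; rewrite subrK.
  - by move=> i; rewrite addrK.
rewrite -ge0_sume_distrr; last by move=> j _; rewrite lee_fin sqr_ge0.
by rewrite lee_wpmul2l// sum_le_l2sq.
Qed.

Local Notation bop := (bop R).
Implicit Types T : bop.

Lemma opnorm_fin T : exists2 a : R, 0 <= a & opnorm T = a%:E.
Proof.
have [M M0 TM] := bop_bound T.
have ub : (opnorm T <= M%:E)%E.
  apply: ge_ereal_sup => _ [x /= x1 <-]; rewrite lee_fin.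
  by apply: (le_trans (TM x)); rewrite ler_piMr.
have lb : (0 <= opnorm T)%E.
  apply: ereal_sup_ubound; exists 0; first by rewrite /= l2norm0.
  by rewrite linear0 l2norm0.
exists (fine (opnorm T)); first exact: fine_ge0.
by rewrite fineK// ge0_fin_numE// (le_lt_trans ub) ?ltry.
Qed.

Lemma opnorm_bound T (a : R) x : opnorm T = a%:E -> l2norm (T x) <= a * l2norm x.
Proof.
move=> Ta; have [x0|x0] := eqVneq (l2norm x) 0.
  by rewrite (l2norm_eq0 x0) linear0 !l2norm0 mulr0.
have X0 : 0 < l2norm x by rewrite lt_def x0 l2norm_ge0.
pose c : C := ((l2norm x)^-1)%:C.
have nc : normc c = (l2norm x)^-1 by rewrite normc_real ger0_norm// invr_ge0 ltW.
have : ((l2norm (T (c *: x)))%:E <= opnorm T)%E.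
  apply: ereal_sup_ubound; exists (c *: x) => //=.
  by rewrite l2normZ nc mulVf.
rewrite Ta lee_fin linearZ l2normZ nc mulrC ler_pdivrMr//.
Qed.

Lemma opnorm_le T (a : R) : (forall x, l2norm (T x) <= a * l2norm x) -> 0 <= a ->
  (opnorm T <= a%:E)%E.
Proof.
move=> Ta a0; apply: ge_ereal_sup => _ [x /= x1 <-]; rewrite lee_fin.
by apply: (le_trans (Ta x)); rewrite ler_piMr.
Qed.

(** The matrix of [T] acts by finite sums on finitely supported vectors, which
    is why the estimates below are made on one coarse block at a time. *)
Lemma bop_finsupp T x (s : seq int) i : uniq s -> (forall k, k \notin s -> x k = 0) ->
  T x i = \sum_(l <- s) bop_mx T i l * x l.
Proof.
move=> us xs.
have {1}-> : x = \sum_(l <- s) x l *: unitvec R l.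
  apply: ell2P => j; rewrite ell2_sum.
  rewrite (eq_bigr (fun l => x l * (j == l)%:R))//.
  case: (boolP (j \in s)) => js; last first.
    rewrite xs// big_seq big1// => l ls; case: eqP => [jl|_]; last by rewrite mulr0.
    by rewrite -jl (negPf js) in ls.
  rewrite (bigD1_seq j)//= eqxx mulr1 big1 ?addr0// => l /negPf lj.
  by rewrite eq_sym lj mulr0.
rewrite linear_sum ell2_sum; apply: eq_bigr => l _.
by rewrite linearZ [RHS]mulrC.
Qed.

End ell2_theory.

(** * Commutators with slowly varying cutoffs *)

Section localisation.
Variable R : realType.
Local Notation C := R[i].
Local Notation ell2 := (ell2 R).
Local Notation bop := (bop R).
Implicit Types (x y : ell2).

Lemma divz_bounds (n : nat) (i : int) : (0 < n)%N ->
  (i %/ n%:Z)%Z * n%:Z <= i < (i %/ n%:Z)%Z * n%:Z + n%:Z.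
Proof.
move=> n0; have iE := divz_eq i n%:Z.
have r0 : 0 <= (i %% n%:Z)%Z by rewrite modz_ge0// gt_eqF.
have rn : (i %% n%:Z)%Z < n%:Z by rewrite ltz_mod// gt_eqF.
by move: iE r0 rn; lia.
Qed.

Definition interval_seq (n : nat) (m : int) : seq int :=
  [seq m * n%:Z + t%:Z | t <- iota 0 n].

Lemma interval_seq_uniq n m : uniq (interval_seq n m).
Proof. by rewrite map_inj_uniq ?iota_uniq// => t t' /addrI[]. Qed.

Lemma mem_interval_seq n m i : (0 < n)%N ->
  (i \in interval_seq n m) = ((i %/ n%:Z)%Z == m).
Proof.
move=> n0; apply/mapP/eqP => [[t]|<-].
  rewrite mem_iota /= add0n => tn ->.
  by rewrite divzMDl ?divz_small ?addr0 ?gt_eqF//; lia.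
have := divz_bounds i n0; exists (absz (i - (i %/ n%:Z)%Z * n%:Z)%R).
  by rewrite mem_iota; lia.
by lia.
Qed.

(** Used at both scales: with [n] for the fine blocks, with [L = n M] for the
    coarse ones. *)
Definition piece (L : nat) (m : int) x := restr (fun j => (j %/ L%:Z)%Z == m) x.

Lemma piece0 L m x j : (j %/ L%:Z)%Z != m -> piece L m x j = 0.
Proof. by move=> /negPf jm; rewrite restrE jm. Qed.

(** The trapezoid, as a function of the number of the fine block. *)
Lemma cutoff_exists (M : nat) (k : int) : (0 < M)%N -> exists c : int -> R,
  [/\ contractive c,
      forall q, (q %/ M%:Z)%Z = k -> c q = 1,
      forall q, (2 <= absz ((q %/ M%:Z)%Z - k)%R)%N -> c q = 0
    & forall p q, (absz (p - q)%R <= 1)%N -> `|c p - c q| <= M%:R^-1].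
Proof.
move=> M0; have M0' : 0 < M%:R :> R by rewrite ltr0n.
(* Twice the distance of [q] to the centre [k M + (M - 1) / 2] of its block. *)
pose D q : nat := absz (2 * q + 1 - (2 * k + 1) * M%:Z)%R.
pose u q : R := (3 * M%:R - (D q)%:R) / (2 * M%:R).
exists (fun q => Num.max 0 (Num.min 1 (u q))); split.
- by move=> q; rewrite le_max lexx/= ge_max ler01/= ge_min lexx.
- move=> q qk; have := divz_bounds q M0; rewrite qk => /andP[q1 q2].
  have DM : (D q <= M)%N by rewrite /D; lia.
  have u1 : 1 <= u q.
    rewrite ler_pdivlMr ?mulr_gt0// mul1r lerBrDr -!natrM -natrD ler_nat; lia.
  by rewrite (min_l u1) max_r.
- move=> q qk; have := divz_bounds q M0 => /andP[q1 q2].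
  have DM : (3 * M <= D q)%N.
    move: q1 q2 qk; set d := (q %/ M%:Z)%Z => q1 q2 qk.
    have [h|h] : d - k <= - 2 \/ 2 <= d - k by lia.
      have : (d - k) * M%:Z <= - 2 * M%:Z by rewrite ler_wpM2r.
      rewrite /D; lia.
    have : 2 * M%:Z <= (d - k) * M%:Z by rewrite ler_wpM2r.
    rewrite /D; lia.
  have u1 : u q <= 0.
    rewrite pmulr_lle0 ?invr_gt0 ?mulr_gt0// subr_le0 -natrM ler_nat; lia.
  rewrite max_l// ge_min u1 orbT//.
- move=> p q pq.
  have : `|u p - u q| <= M%:R^-1.
    have -> : u p - u q = ((D q)%:R - (D p)%:R) / 2 / M%:R.
      by rewrite /u; field; rewrite gt_eqF.
    rewrite normrM (ger0_norm (x := M%:R^-1)) ?invr_ge0//.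
    rewrite ler_piMl ?invr_ge0// normrM (ger0_norm (x := 2^-1))// ler_pdivrMr// mul1r.
    have D1 : (D q <= D p + 2)%N by rewrite /D; lia.
    have D2 : (D p <= D q + 2)%N by rewrite /D; lia.
    move: D1 D2; rewrite -(ler_nat R) -[in X in _ -> X -> _](ler_nat R) !natrD.
    by move=> D1 D2; rewrite ler_norml; apply/andP; split; lra.
  move: (u p) (u q) => a b; rewrite !ler_norml => /andP[h1 h2].
  case: (leP 1 a) => ?; case: (leP 1 b) => ?; case: (leP 0 a) => ?;
    case: (leP 0 b) => ?; rewrite ?(max_r ler01);
    by apply/andP; split; lra.
Qed.

Definition commut (A : bop) (c : int -> R) x : ell2 := A (cut c x) - cut c (A x).

Lemma commutD A c x y : contractive c ->
  commut A c (x + y) = commut A c x + commut A c y.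
Proof.
move=> cc; rewrite /commut.
have cD u v : cut c (u + v) = cut c u + cut c v.
  by apply: ell2P => k; rewrite ell2D !cutE// mulrDr.
by rewrite cD !linearD cD opprD addrACA.
Qed.

Lemma commut_sum A c (I : Type) (r : seq I) (F : I -> ell2) : contractive c ->
  commut A c (\sum_(i <- r) F i) = \sum_(i <- r) commut A c (F i).
Proof.
move=> cc; elim: r => [|i r IH]; last by rewrite !big_cons commutD// IH.
have c0 : cut c 0 = 0 by apply: ell2P => k; rewrite cutE//; exact: mulr0.
by rewrite !big_nil /commut c0 !linear0 c0 subr0.
Qed.

Lemma commut_bound (A : bop) (a : R) c x : 0 <= a -> contractive c ->
  (forall y, l2norm (A y) <= a * l2norm y) ->
  l2norm (commut A c x) <= 2 * a * l2norm x.
Proof.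
move=> a0 cc Aa; apply: (le_trans (l2normD _ _)); rewrite l2normN.
have := le_trans (Aa (cut c x)) (ler_wpM2l a0 (l2norm_cut x cc)).
have := le_trans (l2norm_cut (A x) cc) (Aa x); lra.
Qed.

Lemma commutE (A : bop) c x (s : seq int) i : contractive c -> uniq s ->
  (forall j, j \notin s -> x j = 0) ->
  commut A c x i = \sum_(j <- s) bop_mx A i j * (c j - c i)%:C * x j.
Proof.
move=> cc us xs; rewrite ell2B (@bop_finsupp _ _ _ s)//; last first.
  by move=> j js; rewrite cutE// xs// mulr0.
rewrite cutE// (@bop_finsupp _ A x s)// mulr_sumr -sumrB.
apply: eq_bigr => j _; rewrite cutE// rmorphB /=; ring.
Qed.

Section local_bounds.
Variables (A : bop) (a t : R) (alpha : int -> R) (n M : nat).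
Hypotheses (a0 : 0 <= a) (Aa : forall x, l2norm (A x) <= a * l2norm x).
Hypotheses (alpha0 : forall e, 0 <= alpha e).
Hypothesis Aalpha : forall i j, normc (bop_mx A i j) <= alpha (i - j).
Hypotheses (n0 : (0 < n)%N) (M0 : (0 < M)%N).
Let L := (n * M)%N.
Hypothesis alpha_tail : (tail n (fun e => (alpha e)%:E) <= t%:E)%E.

Lemma L_gt0 : (0 < L)%N. Proof. by rewrite muln_gt0 n0. Qed.

Lemma divz_block j : ((j %/ n%:Z)%Z %/ M%:Z)%Z = (j %/ L%:Z)%Z.
Proof. by rewrite /L PoszM divzMA_ge0. Qed.

Variable (c : int -> R).
Hypotheses (cc : contractive c).
Hypothesis c_lip : forall p q, (absz (p - q)%R <= 1)%N -> `|c p - c q| <= M%:R^-1.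

Let chi i := c (i %/ n%:Z)%Z.

Lemma chi_contractive : contractive chi.
Proof. by move=> i; exact: cc. Qed.

Lemma chiB_le1 i j : `|chi i - chi j| <= 1.
Proof.
have /andP[h1 h2] := cc (i %/ n%:Z)%Z; have /andP[h3 h4] := cc (j %/ n%:Z)%Z.
by rewrite /chi ler_norml; apply/andP; split; lra.
Qed.

Variables (m : int) (x : ell2).
Hypothesis xm : forall j, (j %/ L%:Z)%Z != m -> x j = 0.

Let s := interval_seq L m.
Let Q := interval_seq M m.
Let adjacent (p q : int) := (absz (q - p)%R <= 1)%N.

Lemma xs j : j \notin s -> x j = 0.
Proof. by rewrite mem_interval_seq ?L_gt0//; exact: xm. Qed.

Lemma block_mem j : j \in s -> (j %/ n%:Z)%Z \in Q.
Proof. by rewrite !mem_interval_seq ?L_gt0// divz_block. Qed.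

(** The fine blocks are disjoint. *)
Lemma sum_l2sq_piece : (\sum_(q <- Q) l2sq (piece n q x) <= l2sq x)%E.
Proof.
rewrite /l2sq -esum_sum; last by move=> i j _ _; rewrite lee_fin sqr_ge0.
apply: le_esum => k _.
rewrite (eq_bigr (fun q => if q == (k %/ n%:Z)%Z then (normc (x k) ^+ 2)%:E else 0%E)); last first.
  by move=> q _; rewrite restrE eq_sym; case: eqP => // _; rewrite normc0 expr0n.
have [kQ|kQ] := boolP ((k %/ n%:Z)%Z \in Q).
  rewrite (bigD1_seq (k %/ n%:Z)%Z) ?interval_seq_uniq//= eqxx big1 ?adde0//.
  by move=> q /negPf ->.
rewrite big_seq big1 ?lee_fin ?sqr_ge0// => q qQ; case: eqP => // qk.
by rewrite -qk qQ in kQ.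
Qed.

(** The entries of the commutator that link a fine block to a neighbouring
    one, grouped by blocks: as [chi] is constant on each fine block, every
    group is a multiple of [A (piece n q x)]. *)
Definition adjacent_part i : C :=
  \sum_(q <- Q | adjacent (i %/ n%:Z)%Z q) (c q - c (i %/ n%:Z)%Z)%:C * A (piece n q x) i.

Lemma adjacent_partE i : adjacent_part i =
  \sum_(j <- s | adjacent (i %/ n%:Z)%Z (j %/ n%:Z)%Z)
    bop_mx A i j * (chi j - chi i)%:C * x j.
Proof.
rewrite /adjacent_part.
under eq_bigr => q _.
  rewrite (@bop_finsupp _ A (piece n q x) s) ?interval_seq_uniq//; last first.
    by move=> k ks; rewrite restrE xs// if_same.
  rewrite mulr_sumr.
  over.
rewrite exchange_big [RHS]big_mkcond /=; apply: eq_big_seq => j js.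
rewrite big_mkcond (bigD1_seq (j %/ n%:Z)%Z) ?interval_seq_uniq ?block_mem//=.
rewrite restrE eqxx big1 ?addr0.
  by case: ifP => // _; rewrite /chi; ring.
by move=> q /negPf qj; rewrite restrE eq_sym qj !mulr0 if_same.
Qed.

(** Each output coordinate receives at most three groups, each multiplied by
    a jump at most [1 / M] of the cutoff.  Squaring and summing, the squared
    norms of the [A (piece n q x)] add up to at most [a^2 |x|^2]; no norm of
    [A] finer than the operator norm is involved. *)
Lemma adjacent_part_bound : (l2sq adjacent_part <= ((3 * a / M%:R) ^+ 2)%:E * l2sq x)%E.
Proof.
have Mi : 0 <= M%:R^-1 :> R by rewrite invr_ge0.
have pt i : normc (adjacent_part i) ^+ 2 <=
    3 / M%:R ^+ 2 * \sum_(q <- Q) normc (A (piece n q x) i) ^+ 2.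
  set p := (i %/ n%:Z)%Z.
  pose k q : R := if adjacent p q then M%:R^-1 else 0.
  have k0 q : 0 <= k q by rewrite /k; case: ifP.
  have kM q : k q <= M%:R^-1 by rewrite /k; case: ifP.
  apply: (@le_trans _ _ ((\sum_(q <- Q) k q * normc (A (piece n q x) i)) ^+ 2)).
    rewrite lerXn2r// ?nnegrE ?normc_ge0//.
      by rewrite sumr_ge0// => q _; rewrite mulr_ge0// normc_ge0.
    rewrite /adjacent_part big_mkcond /=; apply: (le_trans (normc_sum_le _ _)).
    apply: ler_sum => q _; rewrite /k; case: ifPn => pq; last by rewrite normc0 mul0r.
    by rewrite normcM normc_real ler_wpM2r ?normc_ge0// c_lip.
  apply: (le_trans (cauchy_schwarz_weighted _ _ _)) => // [q|]; first exact: normc_ge0.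
  have kcount : \sum_(q <- Q) k q <= 3 / M%:R.
    rewrite /k -big_mkcond /= big_const_seq iter_addr_0 -[X in X <= _]mulr_natl.
    rewrite ler_wpM2r// ler_nat -size_filter.
    apply: (@uniq_leq_size _ _ [:: p - 1; p; p + 1]).
      by rewrite filter_uniq// interval_seq_uniq.
    move=> q; rewrite mem_filter !inE /adjacent => /andP[h _]; lia.
  have -> : 3 / M%:R ^+ 2 = 3 / M%:R * M%:R^-1 :> R by rewrite expr2 invfM mulrA.
  rewrite -(mulrA (3 / M%:R)); apply: ler_pM => //.
  - by apply: sumr_ge0.
  - by apply: sumr_ge0 => q _; rewrite mulr_ge0// sqr_ge0.
  - rewrite mulr_sumr; apply: ler_sum => q _.
    by rewrite ler_wpM2r// sqr_ge0.
have c0 : 0 <= 3 / M%:R ^+ 2 :> R by rewrite divr_ge0// exprn_ge0.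
apply: (@le_trans _ _ (\esum_(i in [set: int]) ((3 / M%:R ^+ 2)%:E *
   \sum_(q <- Q) (normc (A (piece n q x) i) ^+ 2)%:E)))%E.
  by apply: le_esum => i _; rewrite sumEFin -EFinM lee_fin.
rewrite esumZ//; last by move=> i; apply: sume_ge0 => q _; rewrite lee_fin sqr_ge0.
rewrite esum_sum; last by move=> i q _ _; rewrite lee_fin sqr_ge0.
apply: (@le_trans _ _ ((3 / M%:R ^+ 2)%:E * \sum_(q <- Q) ((a ^+ 2)%:E * l2sq (piece n q x))))%E.
  rewrite lee_wpmul2l//; apply: lee_sum => q _.
  rewrite -[leLHS]/(l2sq (A (piece n q x))) !l2sqE -EFinM lee_fin -exprMn.
  by rewrite lerXn2r// ?nnegrE ?mulr_ge0 ?l2norm_ge0.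
rewrite -ge0_sume_distrr; last by move=> q _; exact: l2sq_ge0.
apply: (@le_trans _ _ ((3 / M%:R ^+ 2)%:E * ((a ^+ 2)%:E * l2sq x)))%E.
  by rewrite !lee_wpmul2l ?lee_fin ?sqr_ge0//; exact: sum_l2sq_piece.
rewrite muleA -EFinM lee_wpmul2r ?l2sq_ge0// lee_fin.
have -> : (3 * a / M%:R) ^+ 2 = 9 * (a ^+ 2 / M%:R ^+ 2).
  by rewrite !exprMn exprVn; ring.
rewrite mulrAC -mulrA ler_wpM2r ?ler_nat//.
by rewrite divr_ge0 ?sqr_ge0.
Qed.

Definition distant_part i : C := commut A chi x i - adjacent_part i.

(** Indices in non-adjacent fine blocks differ by more than [n]. *)
Lemma distant_part_bound : (l2sq distant_part <= (t ^+ 2)%:E * l2sq x)%E.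
Proof.
pose k e : R := if (n <= (absz e).+1)%N then alpha e else 0.
apply: (@schur_bound _ _ _ k s).
- by move=> e; rewrite /k; case: ifP.
- apply: le_trans alpha_tail; rewrite /tail [leRHS]esum_mkcond; apply: le_esum => e _.
  rewrite /k; case: ifPn => h; first by rewrite ifT// inE.
  by case: ifP => _; rewrite lee_fin.
- exact: interval_seq_uniq.
- move=> i; rewrite /distant_part (@commutE A chi x s) ?interval_seq_uniq//.
  + rewrite adjacent_partE (bigID (fun j => adjacent (i %/ n%:Z)%Z (j %/ n%:Z)%Z)) /=.
    rewrite addrAC subrr add0r big_mkcond; apply: (le_trans (normc_sum_le _ _)).
    apply: ler_sum => j _; case: ifPn => [ij|_]; last first.
      by rewrite normc0 mulr_ge0 ?normc_ge0// /k; case: ifP.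
    rewrite normcM ler_wpM2r ?normc_ge0// normcM normc_real.
    rewrite /k ifT; last first.
      move: ij; rewrite /adjacent.
      have := divz_bounds i n0; have := divz_bounds j n0.
      set q := (j %/ n%:Z)%Z; set p := (i %/ n%:Z)%Z => hj hi pq.
      have [h|h] : q - p <= - 2 \/ 2 <= q - p by lia.
        have : (q - p) * n%:Z <= - 2 * n%:Z by rewrite ler_wpM2r.
        lia.
      have : 2 * n%:Z <= (q - p) * n%:Z by rewrite ler_wpM2r.
      lia.
    rewrite -[leRHS]mulr1; apply: ler_pM => //; first exact: normc_ge0.
    exact: chiB_le1.
  + exact: chi_contractive.
  + exact: xs.
Qed.

(** For an arbitrary coarse block; it is used for blocks close to the one that
    carries the cutoff. *)
Lemma commut_near : 0 <= t ->
  l2norm (commut A chi x) <= (3 * a / M%:R * 2 + 2 * t) * l2norm x.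
Proof.
move=> t0.
have A0 : 0 <= 3 * a / M%:R by rewrite divr_ge0 ?mulr_ge0.
apply: l2norm_le; first by rewrite addr_ge0 ?mulr_ge0.
have -> : l2sq (commut A chi x) = l2sq (adjacent_part + distant_part)%R.
  by congr l2sq; apply/funext => i; rewrite fctE /distant_part addrC subrK.
apply: (le_trans (l2sqD _ _)).
apply: (@le_trans _ _ (2%:E * (((3 * a / M%:R) ^+ 2)%:E * l2sq x + (t ^+ 2)%:E * l2sq x)))%E.
  by rewrite lee_wpmul2l//; apply: leeD; [exact: adjacent_part_bound|exact: distant_part_bound].
rewrite -ge0_muleDl ?lee_fin ?sqr_ge0// muleA -EFinD -EFinM.
rewrite lee_wpmul2r ?l2sq_ge0// lee_fin; nra.
Qed.

End local_bounds.

Lemma coarse_diff (L : nat) (k m i j : int) : (0 < L)%N ->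
  (absz ((i %/ L%:Z)%Z - k)%R <= 1)%N -> (j %/ L%:Z)%Z = m ->
  (absz (i - j - (k - m) * L%:Z)%R < 2 * L)%N.
Proof.
move=> L0 ik jm.
have := divz_bounds i L0; have := divz_bounds j L0; rewrite jm.
move: ik; set p := (i %/ L%:Z)%Z => ik hj hi.
have : (p - k) * L%:Z <= 1 * L%:Z by rewrite ler_wpM2r//; lia.
have : -1 * L%:Z <= (p - k) * L%:Z by rewrite ler_wpM2r//; lia.
move: hi hj; rewrite !mulrBl; lia.
Qed.

(** The cutoff vanishes on the support of [x], so the commutator is
    [- chi A x], and only entries near the diagonal number [(k - m) L] remain. *)
Lemma commut_far (A : bop) (alpha chi : int -> R) (L : nat) (k m : int) x (T : R) :
  (0 < L)%N -> (forall e, 0 <= alpha e) ->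
  (forall i j, normc (bop_mx A i j) <= alpha (i - j)) ->
  contractive chi ->
  (forall i, (2 <= absz ((i %/ L%:Z)%Z - k)%R)%N -> chi i = 0) ->
  (forall j, (j %/ L%:Z)%Z != m -> x j = 0) ->
  (3 <= absz (k - m)%R)%N -> (far L (fun e => (alpha e)%:E) (k - m) <= T%:E)%E ->
  l2norm (commut A chi x) <= T * l2norm x.
Proof.
move=> L0 alpha0 Aalpha cc chi0 xm km farT.
have T0 : 0 <= T.
  by rewrite -lee_fin; apply: le_trans farT; apply: far_ge0 => e; rewrite lee_fin.
apply: l2norm_le => //.
pose s := interval_seq L m.
have xs j : j \notin s -> x j = 0 by rewrite mem_interval_seq//; exact: xm.
pose S := [set e : int | (absz (e - (k - m) * L%:Z)%R < 2 * L)%N].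
pose kap e : R := if (absz (e - (k - m) * L%:Z)%R < 2 * L)%N then alpha e else 0.
have kap0 e : 0 <= kap e by rewrite /kap; case: ifP.
apply: (@schur_bound _ _ _ kap s) => //.
- apply: le_trans farT; rewrite /far km [leRHS]esum_mkcond; apply: le_esum => e _.
  rewrite /kap; case: ifPn => h; first by rewrite ifT// inE.
  by case: ifP => _; rewrite lee_fin.
- exact: interval_seq_uniq.
- move=> i; rewrite (@commutE A chi x s) ?interval_seq_uniq//.
  apply: (le_trans (normc_sum_le _ _)); rewrite big_seq [leRHS]big_seq.
  apply: ler_sum => j; rewrite mem_interval_seq// => /eqP jm.
  rewrite [chi j]chi0 ?jm; last by lia.
  rewrite normcM ler_wpM2r ?normc_ge0// normcM normc_real sub0r normrN.
  have /andP[c0 c1] := cc i.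
  case: (leqP 2 (absz ((i %/ L%:Z)%Z - k)%R)) => ik.
    by rewrite chi0// normr0 mulr0.
  rewrite /kap ifT; last exact: coarse_diff.
  by rewrite ger0_norm// -[leRHS]mulr1; apply: ler_pM => //; exact: normc_ge0.
Qed.

(** [h] is the bound from [commut_near], and the far part comes from
    [commut_far]. *)
Definition kernel (L : nat) (h : R) (alpha : int -> \bar R) (d : int) : \bar R :=
  (h%:E * (if (absz d <= 2)%N then 1 else 0) + far L alpha d)%E.

Lemma kernel_ge0 L h alpha : 0 <= h -> (forall e, 0 <= alpha e)%E ->
  forall d, (0 <= kernel L h alpha d)%E.
Proof.
move=> h0 alpha0 d; rewrite adde_ge0 ?far_ge0// mule_ge0 ?lee_fin//.
by case: ifP.
Qed.

Lemma sum_piece_restr L (ms : seq int) x : uniq ms ->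
  \sum_(m <- ms) piece L m x = restr (fun j => (j %/ L%:Z)%Z \in ms) x.
Proof.
move=> us; apply: ell2P => j; rewrite ell2_sum restrE.
case: ifPn => jm.
  rewrite (bigD1_seq (j %/ L%:Z)%Z)//= restrE eqxx big1 ?addr0// => m mj.
  by rewrite piece0// eq_sym.
rewrite big_seq big1// => m mms; rewrite piece0//; apply: contraNneq jm => ->.
by [].
Qed.

Section kernel_estimate.
Variables (A : bop) (a t K : R) (alpha : int -> R) (n M : nat).
Hypotheses (a0 : 0 <= a) (Aa : forall x, l2norm (A x) <= a * l2norm x).
Hypotheses (K0 : 0 <= K) (AK : forall x, l2norm x <= K * l2norm (A x)).
Hypotheses (alpha0 : forall e, 0 <= alpha e).
Hypothesis Aalpha : forall i j, normc (bop_mx A i j) <= alpha (i - j).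
Hypotheses (n0 : (0 < n)%N) (M0 : (0 < M)%N).
Let L := (n * M)%N.
Hypothesis alpha_sum : (\esum_(e in [set: int]) (alpha e)%:E < +oo)%E.
Hypothesis alpha_tail : (tail n (fun e => (alpha e)%:E) <= t%:E)%E.
Let ker := kernel L (3 * a / M%:R * 2 + 2 * t) (fun e => (alpha e)%:E).

Let t0 : 0 <= t.
Proof.
by rewrite -lee_fin; apply: le_trans alpha_tail; apply: esum_ge0 => e _; rewrite lee_fin.
Qed.

Let L0 : (0 < L)%N. Proof. by rewrite muln_gt0 n0. Qed.

Let h0 : 0 <= 3 * a / M%:R * 2 + 2 * t.
Proof. by rewrite addr_ge0 ?mulr_ge0 ?invr_ge0. Qed.

Lemma ker_ge0 d : (0 <= ker d)%E.
Proof. by apply: kernel_ge0 => // e; rewrite lee_fin. Qed.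

Lemma commut_kernel k (c : int -> R) m x :
  contractive c ->
  (forall q, (2 <= absz ((q %/ M%:Z)%Z - k)%R)%N -> c q = 0) ->
  (forall p q, (absz (p - q)%R <= 1)%N -> `|c p - c q| <= M%:R^-1) ->
  (forall j, (j %/ L%:Z)%Z != m -> x j = 0) ->
  ((l2norm (commut A (fun i => c (i %/ n%:Z)%Z) x))%:E <=
    ker (k - m) * (l2norm x)%:E)%E.
Proof.
move=> cc c0 c_lip xm; rewrite /ker /kernel.
have [km|km] := leqP (absz (k - m)) 2.
  rewrite mule1 /far ifF ?adde0; last by apply/negbTE; rewrite -ltnNge ltnS.
  rewrite -EFinM lee_fin; apply: (@commut_near A a t alpha n M) => //; exact: xm.
rewrite mule0 add0e.
have ffar : far L (fun e => (alpha e)%:E) (k - m) \is a fin_num.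
  rewrite ge0_fin_numE; last by apply: far_ge0 => e; rewrite lee_fin.
  apply: le_lt_trans alpha_sum; rewrite /far km esum_mkcond.
  by apply: le_esum => e _; case: ifP => // _; rewrite lee_fin.
rewrite -(fineK ffar) -EFinM lee_fin.
apply: (@commut_far A alpha (fun i => c (i %/ n%:Z)%Z) L k m) => //.
- by move=> i ik; rewrite c0// divz_block.
- by rewrite fineK.
Qed.

(** The localised lower bound for [A].  Finitely many coarse blocks carry [x]
    up to a small error, on which the commutator is bounded by twice the norm
    of [A]; this reduces the estimate to finite sums. *)
Lemma piece_kernel k x : exists chi : int -> R,
  [/\ contractive chi,
      forall i, (2 <= absz ((i %/ L%:Z)%Z - k)%R)%N -> chi i = 0 &
   ((l2norm (piece L k x))%:E <= K%:E * ((l2norm (cut chi (A x)))%:E +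
     \esum_(m in [set: int]) (ker (k - m)%R * (l2norm (piece L m x))%:E)))%E].
Proof.
have [c [cc c1 c0 c_lip]] := cutoff_exists k M0.
pose chi i := c (i %/ n%:Z)%Z.
have chic : contractive chi by move=> i; exact: cc.
exists chi; split => //.
  by move=> i ik; rewrite /chi c0// divz_block.
set E := esum _ _.
have E0 : (0 <= E)%E.
  by apply: esum_ge0 => m _; rewrite mule_ge0 ?ker_ge0// lee_fin l2norm_ge0.
have le1 : l2norm (piece L k x) <= l2norm (cut chi x).
  rewrite -[leRHS]mul1r; apply: l2norm_le => //; rewrite expr1n mul1e.
  apply: le_esum => j _; rewrite lee_fin lerXn2r// ?nnegrE ?normc_ge0//.
  rewrite restrE cutE//; case: eqP => jk; last by rewrite normc0 normc_ge0.
  by rewrite /chi c1 ?divz_block// mul1r.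
have le2 : l2norm (cut chi x) <= K * (l2norm (cut chi (A x)) + l2norm (commut A chi x)).
  apply: (le_trans (AK _)); rewrite ler_wpM2l//.
  have -> : A (cut chi x) = cut chi (A x) + commut A chi x.
    by rewrite /commut addrC subrK.
  exact: l2normD.
apply: (@le_trans _ _ (K * (l2norm (cut chi (A x)) + l2norm (commut A chi x)))%:E).
  by rewrite lee_fin (le_trans le1).
rewrite EFinM EFinD lee_wpmul2l// leeD2l//.
apply/lee_addgt0Pr => e e0.
(* Adding 1 keeps the tolerance positive when [a = 0]. *)
have d0 : 0 < e / (2 * a + 1) by rewrite divr_gt0// ltr_wpDl// mulr_ge0.
have [s sP] := ell2_tail x d0.
pose ms := undup [seq (j %/ L%:Z)%Z | j <- s].
pose y := \sum_(m <- ms) piece L m x.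
have xy : l2norm (x - y) <= e / (2 * a + 1).
  rewrite /y sum_piece_restr ?undup_uniq//; apply: sP => j js.
  by rewrite mem_undup; apply: (map_f (fun j : int => (j %/ L%:Z)%Z)).
have -> : commut A chi x = commut A chi y + commut A chi (x - y).
  by rewrite -commutD// addrC subrK.
apply: (@le_trans _ _ (l2norm (commut A chi y) + l2norm (commut A chi (x - y)))%:E).
  by rewrite lee_fin l2normD.
rewrite EFinD; apply: leeD; last first.
  rewrite lee_fin; apply: (le_trans (commut_bound _ a0 chic Aa)).
  apply: (@le_trans _ _ (2 * a * (e / (2 * a + 1)))).
    by rewrite ler_wpM2l// mulr_ge0.
  rewrite mulrCA ler_piMr ?(ltW e0)// ler_pdivrMr ?mul1r ?lerDl//.
  by rewrite ltr_wpDl// mulr_ge0.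
rewrite /y commut_sum//.
apply: (@le_trans _ _ (\sum_(m <- ms) (l2norm (commut A chi (piece L m x)))%:E)%E).
  by rewrite sumEFin lee_fin l2norm_sum.
apply: (@le_trans _ _ (\sum_(m <- ms) (ker (k - m)%R * (l2norm (piece L m x))%:E))%E).
  apply: lee_sum => m _; apply: commut_kernel => // j; exact: piece0.
rewrite fsbig_seq ?undup_uniq//; apply: esum_ge; exists [set` ms] => //.
by split => //; exact: finite_seq.
Qed.

End kernel_estimate.

End localisation.

(** * Columns of the inverse *)

Section inverse.
Variable R : realType.
Local Notation C := R[i].
Local Notation ell2 := (ell2 R).
Local Notation bop := (bop R).
Implicit Types (x y : ell2) (A B : bop).

(** Both norms in the statement depend on a matrix through this sequence
    only. *)
Definition diag_sup (m : int -> int -> C) (k : int) : \bar R :=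
  ereal_sup [set (normc (m l (l - k)%R))%:E | l in [set: int]].

Lemma diag_sup_ge (m : int -> int -> C) i j :
  ((normc (m i j))%:E <= diag_sup m (i - j))%E.
Proof. by apply: ereal_sup_ubound; exists i => //; rewrite opprB addrC subrK. Qed.

Lemma diag_sup_ge0 m k : (0 <= diag_sup m k)%E.
Proof.
have := diag_sup_ge m k 0; rewrite subr0; apply: le_trans.
by rewrite lee_fin normc_ge0.
Qed.

Lemma l2norm_unitvec j : l2norm (unitvec R j) = 1.
Proof. by rewrite /l2norm l2sq_unitvec sqrtr1. Qed.

Lemma diag_sup_le A (a : R) k : (forall x, l2norm (A x) <= a * l2norm x) ->
  (diag_sup (bop_mx A) k <= a%:E)%E.
Proof.
move=> Aa; apply: ge_ereal_sup => _ [l _ <-]; rewrite lee_fin.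
apply: (le_trans (normc_le_l2norm _ _)); apply: (le_trans (Aa _)).
by rewrite l2norm_unitvec mulr1.
Qed.

(** Schur's test for [A] itself, extended from finitely supported vectors by
    density. *)
Lemma opnorm_le_sum A (T : R) :
  (\esum_(e in [set: int]) diag_sup (bop_mx A) e <= T%:E)%E ->
  (opnorm A <= T%:E)%E.
Proof.
move=> AT; have [a a0 Aa] := opnorm_fin A.
have T0 : 0 <= T.
  by rewrite -lee_fin; apply: le_trans AT; apply: esum_ge0 => e _; exact: diag_sup_ge0.
have dfin e : diag_sup (bop_mx A) e = (fine (diag_sup (bop_mx A) e))%:E.
  rewrite fineK// ge0_fin_numE ?diag_sup_ge0//; apply: le_lt_trans (ltry a).
  by apply: diag_sup_le => x; exact: opnorm_bound.
apply: opnorm_le => // x; apply/ler_addgt0Pr => e e0.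
have d0 : 0 < e / (a + 1) by rewrite divr_gt0// ltr_wpDl.
have [s sP] := ell2_tail x d0.
pose y := restr (mem s) x.
have -> : A x = A y + A (x - y) by rewrite -linearD addrC subrK.
apply: (le_trans (l2normD _ _)); apply: lerD.
  apply: (@le_trans _ _ (T * l2norm y)); last by rewrite ler_wpM2l// l2norm_restr.
  have ys k : k \notin undup s -> y k = 0.
    by rewrite mem_undup /y restrE /= => /negPf ->.
  apply: l2norm_le => //.
  apply: (@schur_bound _ _ _ (fun e => fine (diag_sup (bop_mx A) e)) (undup s)).
  - by move=> i; rewrite fine_ge0// diag_sup_ge0.
  - by under eq_esum do rewrite -dfin.
  - exact: undup_uniq.
  - move=> i; rewrite (@bop_finsupp _ A y (undup s)) ?undup_uniq//.
    apply: (le_trans (normc_sum_le _ _)); apply: ler_sum => j _.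
    rewrite normcM ler_wpM2r ?normc_ge0// -lee_fin -dfin.
    exact: diag_sup_ge.
apply: (le_trans (opnorm_bound _ Aa)).
apply: (@le_trans _ _ (a * (e / (a + 1)))).
  by rewrite ler_wpM2l//; apply: sP.
rewrite mulrCA ler_piMr ?(ltW e0)// ler_pdivrMr ?mul1r ?lerDl//.
by rewrite ltr_wpDl.
Qed.

Section blocks.
Variables (B : bop) (K : R) (L : nat).
Hypotheses (K0 : 0 <= K) (BK : forall x, l2norm (B x) <= K * l2norm x).
Hypothesis L0 : (0 < L)%N.

(** The largest size of a column of [B] at signed coarse distance [d] from its
    diagonal entry. *)
Definition block_decay (d : int) : \bar R :=
  ereal_sup [set (l2norm (piece L ((j %/ L%:Z)%Z + d) (B (unitvec R j))))%:E
            | j in [set: int]].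

Lemma block_decay_ge0 d : (0 <= block_decay d)%E.
Proof.
apply: le_trans (_ : (l2norm (piece L ((0 %/ L%:Z)%Z + d) (B (unitvec R 0))))%:E <= _)%E.
  by rewrite lee_fin l2norm_ge0.
by apply: ereal_sup_ubound; exists 0.
Qed.

Lemma block_decay_le d : (block_decay d <= K%:E)%E.
Proof.
apply: ge_ereal_sup => _ [j _ <-]; rewrite lee_fin.
apply: (le_trans (l2norm_restr _ _)); apply: (le_trans (BK _)).
by rewrite l2norm_unitvec mulr1.
Qed.

(** Coarse differences determine differences of coarse blocks up to one unit;
    hence the two terms in [decay_dilate]. *)
Lemma divz_sub_cases i j : (i %/ L%:Z)%Z - (j %/ L%:Z)%Z = ((i - j) %/ L%:Z)%Z \/
  (i %/ L%:Z)%Z - (j %/ L%:Z)%Z = ((i - j) %/ L%:Z)%Z + 1.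
Proof.
have := divz_bounds i L0; have := divz_bounds j L0.
have := divz_bounds (i - j) L0.
set p := (i %/ _)%Z; set q := (j %/ _)%Z; set r := ((i - j) %/ _)%Z => hr hq hp.
suff : - 1 < p - q - r < 2 by lia.
have L0' : 0 < L%:Z by rewrite ltz_nat.
rewrite -(ltr_pM2r L0') -(ltr_pM2r L0' _ 2) !mulrBl.
lia.
Qed.

Lemma diag_sup_block e : (diag_sup (bop_mx B) e <=
  block_decay (e %/ L%:Z)%Z + block_decay ((e %/ L%:Z)%Z + 1))%E.
Proof.
apply: ge_ereal_sup => _ [l _ <-].
set j := l - e; set q := (e %/ L%:Z)%Z.
apply: (@le_trans _ _ (block_decay ((l %/ L%:Z)%Z - (j %/ L%:Z)%Z))).
  apply: le_trans (_ : (l2norm (piece L (l %/ L%:Z)%Z (B (unitvec R j))))%:E <= _)%E.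
    rewrite lee_fin; apply: le_trans (normc_le_l2norm _ l).
    by rewrite /piece restrE eqxx.
  apply: ereal_sup_ubound; exists j; first by [].
  by rewrite addrC subrK.
have -> : q = ((l - j) %/ L%:Z)%Z by rewrite /j opprB addrC subrK.
by case: (divz_sub_cases l j) => ->;
  [apply: leeDl|apply: leeDr]; exact: block_decay_ge0.
Qed.

End blocks.

Section block_renewal.
Variables (A B : bop) (a t K : R) (n M : nat).
Hypotheses (a0 : 0 <= a) (Aa : forall x, l2norm (A x) <= a * l2norm x).
Hypotheses (K0 : 0 <= K) (BK : forall x, l2norm (B x) <= K * l2norm x).
Hypotheses (AB : A * B = 1) (BA : B * A = 1).
Hypotheses (n0 : (0 < n)%N) (M0 : (0 < M)%N).
Let L := (n * M)%N.
Hypothesis A_sum : (\esum_(e in [set: int]) diag_sup (bop_mx A) e < +oo)%E.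
Hypothesis A_tail : (tail n (diag_sup (bop_mx A)) <= t%:E)%E.
Let ker := kernel L (3 * a / M%:R * 2 + 2 * t) (diag_sup (bop_mx A)).

(** For the column [x = B e_j], the vector [A x = e_j] lives in a single coarse
    block, so the source term of the localised estimate is supported at small
    coarse distances. *)
Lemma block_decay_renewal d : (block_decay B L d <=
  K%:E * (if (absz d <= 2)%N then 1 else 0)
  + conv (fun d => K%:E * ker d) (block_decay B L) d)%E.
Proof.
have ABx x : A (B x) = x by rewrite -[LHS]/((A * B) x) AB.
have BAx x : B (A x) = x by rewrite -[LHS]/((B * A) x) BA.
have AK x : l2norm x <= K * l2norm (A x) by rewrite -{1}(BAx x).
pose alpha e := fine (diag_sup (bop_mx A) e).
have alphaE : (fun e => (alpha e)%:E) = diag_sup (bop_mx A).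
  apply/funext => e; rewrite fineK// ge0_fin_numE ?diag_sup_ge0//.
  by apply: le_lt_trans (ltry a); exact: diag_sup_le.
have alpha0 e : 0 <= alpha e by rewrite fine_ge0// diag_sup_ge0.
have Aalpha i j : normc (bop_mx A i j) <= alpha (i - j).
  by rewrite -lee_fin -[X in (_ <= X)%E]/((fun e => (alpha e)%:E) (i - j)) alphaE diag_sup_ge.
have t0 : 0 <= t.
  by rewrite -lee_fin; apply: le_trans A_tail; apply: esum_ge0 => e _; exact: diag_sup_ge0.
have ker0 e : (0 <= ker e)%E.
  apply: kernel_ge0; last by move=> ?; exact: diag_sup_ge0.
  by rewrite addr_ge0 ?mulr_ge0 ?invr_ge0.
apply: ge_ereal_sup => _ [j _ <-].
have := @piece_kernel R A a t K alpha n M a0 Aa K0 AK alpha0 Aalpha n0 M0.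
rewrite alphaE => /(_ A_sum A_tail ((j %/ L%:Z)%Z + d) (B (unitvec R j))).
move=> [chi [chic chi0]] /le_trans; apply; rewrite ABx.
rewrite ge0_muleDr; first last.
- by apply: esum_ge0 => m _; rewrite mule_ge0// lee_fin l2norm_ge0.
- by rewrite lee_fin l2norm_ge0.
apply: leeD.
  rewrite lee_wpmul2l//; case: ifPn => d2; rewrite lee_fin.
    by rewrite -(l2norm_unitvec j) l2norm_cut.
  have -> : cut chi (unitvec R j) = 0.
    apply: ell2P => i; rewrite cutE//; have [->|ij] := eqVneq i j.
      rewrite chi0 ?mul0r// opprD addrA subrr sub0r abszN.
      by rewrite -ltnNge in d2; exact: ltnW.
    rewrite -[unitvec R j i]/((i == j)%:R) (negPf ij); exact: mulr0.
  by rewrite l2norm0.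
rewrite /conv; under [leRHS]eq_esum do rewrite -muleA.
rewrite esumZ//; last by move=> m; rewrite mule_ge0// block_decay_ge0.
rewrite lee_wpmul2l//.
(* Reindexing by coarse distance to the block of [j] turns the sum into a convolution. *)
rewrite -(@esum_setT_bij R (fun m => (j %/ L%:Z)%Z + d - m) (fun m => (j %/ L%:Z)%Z + d - m)).
- apply: le_esum => m _; rewrite subKr lee_wpmul2l//.
  by apply: ereal_sup_ubound; exists j; rewrite ?addrA.
- by move=> m; rewrite subKr.
- by move=> m; rewrite subKr.
Qed.

End block_renewal.

End inverse.

(** * Quantitative inversion *)

Section quantitative.
Variable R : realType.
Local Notation bop := (bop R).

Lemma esum_kernel (n L : nat) (h t : R) (u : int -> \bar R) : (n <= L)%N ->
  0 <= h -> (forall e, 0 <= u e)%E -> (tail n u <= t%:E)%E ->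
  (\esum_(d in [set: int]) kernel L h u d <= (5 * h + 4 * t)%:E)%E.
Proof.
move=> nL h0 u0 ut.
have i0 d : (0 <= (if (absz d <= 2)%N then 1 else 0 : \bar R))%E by case: ifP.
rewrite /kernel esumD; first last.
- by move=> d _; exact: far_ge0.
- by move=> d _; rewrite mule_ge0.
rewrite EFinD; apply: leeD.
  rewrite esumZ// mulrC EFinM lee_wpmul2l//; exact: esum_near.
apply: (le_trans (esum_far _ u0)); rewrite EFinM lee_wpmul2l//.
exact: le_trans (le_tail nL u0) ut.
Qed.

(** The near part contributes [h D], the far part a tail. *)
Lemma decay_kernel (s D h t : R) p (n L : nat) (u : int -> \bar R) :
  decay_norm s D p -> 0 <= h -> (0 < L)%N -> (forall e, 0 <= u e)%E ->
  ((D * L%:R `^ (- s))%:E * p u <= t%:E)%E ->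
  (p (kernel L h u) <= (h * D + t)%:E)%E.
Proof.
move=> pP h0 L0 u0 ut.
have i0 d : (0 <= (if (absz d <= 2)%N then 1 else 0 : \bar R))%E by case: ifP.
apply: (le_trans (decay_add pP _ _)).
- by move=> d; rewrite mule_ge0.
- exact: far_ge0.
rewrite EFinD; apply: leeD.
  apply: (le_trans (decay_scale pP h0 i0)); rewrite EFinM lee_wpmul2l//.
  exact: decay_near pP.
exact: le_trans (decay_far pP L0 u0) ut.
Qed.

Lemma nat_above (x : R) : 1 <= x -> exists n : nat,
  [/\ (0 < n)%N, x <= n%:R & n%:R <= 2 * x].
Proof.
move=> x1; exists (Num.truncn x).+1; split => //.
  by rewrite ltW// truncnS_gt.
have : (Num.truncn x)%:R <= x by rewrite truncn_le; lra.
by rewrite -addn1 natrD; lra.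
Qed.

Lemma powRD_gt0 (x r s : R) : 0 < x -> x `^ (r + s) = x `^ r * x `^ s.
Proof. by move=> x0; rewrite powRD// (gt_eqF x0) implybT. Qed.

(** The two lower bounds on [n] and [M] make [K t] and [K a / M] so small that
    [2 D] times the l1 norm of [K ker] is at most 1; the constants 56 and 120
    balance the contributions [14 t] and [30 a / M] of tail and jumps to that
    norm. *)
Lemma block_decay_bound (s D : R) p (A B : bop) (a K N : R) (n M : nat) :
  decay_norm s D p -> A * B = 1 -> B * A = 1 -> 0 < a -> 0 < K -> 0 <= N ->
  (forall x, l2norm (A x) <= a * l2norm x) ->
  (forall x, l2norm (B x) <= K * l2norm x) ->
  p (diag_sup (bop_mx A)) = N%:E -> (0 < n)%N -> (0 < M)%N ->
  56 * D ^+ 2 * (K * N) <= n%:R `^ s -> 120 * D * (K * a) <= M%:R ->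
  (p (block_decay B (n * M)) <= (22 * D * K)%:E)%E.
Proof.
move=> pP AB BA a0 K0 N0 Aa BK pA n0 M0 nX MZ.
have D1 := decay_ge1 pP; have s0 := decay_gt0 pP.
have D0 : 0 < D by lra.
have L0 : (0 < n * M)%N by rewrite muln_gt0 n0.
have nL : (n <= n * M)%N by rewrite leq_pmulr.
set u := diag_sup (bop_mx A) in pA *.
have u0 e : (0 <= u e)%E by exact: diag_sup_ge0.
have M0' : 0 < M%:R :> R by rewrite ltr0n.
have n0' : 0 < n%:R :> R by rewrite ltr0n.
have ns0 : 0 < n%:R `^ s :> R by rewrite powR_gt0.
pose t : R := D * n%:R `^ (- s) * N.
have ut : (tail n u <= t%:E)%E by rewrite EFinM -pA; exact: decay_tail pP _ _ n0 u0.
have t0 : 0 <= t by rewrite !mulr_ge0 ?powR_ge0// ltW.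
have Kt : 56 * D * (K * t) <= 1.
  have -> : 56 * D * (K * t) = 56 * D ^+ 2 * (K * N) * n%:R `^ (- s).
    by rewrite /t; ring.
  by rewrite powRN ler_pdivrMr// mul1r.
have KaM : 120 * D * (K * (a / M%:R)) <= 1.
  by rewrite !mulrA ler_pdivrMr// mul1r -mulrA.
pose h : R := 3 * a / M%:R * 2 + 2 * t.
have hE : K * h = 6 * (K * (a / M%:R)) + 2 * (K * t) by rewrite /h; ring.
have h0 : 0 <= h by rewrite addr_ge0 ?mulr_ge0 ?invr_ge0// ltW.
pose ker := kernel (n * M) h u.
have ker0 d : (0 <= ker d)%E by exact: kernel_ge0.
have usum : (\esum_(e in [set: int]) u e < +oo)%E.
  rewrite -esum_tail1; apply: (le_lt_trans (decay_tail pP _ u0)) => //.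
  by rewrite pA -EFinM ltry.
have Lt : ((D * (n * M)%:R `^ (- s))%:E * p u <= t%:E)%E.
  rewrite pA -EFinM lee_fin /t ler_wpM2r// ler_wpM2l ?(ltW D0)//.
  rewrite !powRN lef_pV2 ?posrE ?powR_gt0// ?ltr0n//.
  by apply: le_powR2; rewrite ?ler_nat// ltW.
have i0 d : (0 <= (if (absz d <= 2)%N then 1 else 0 : \bar R))%E by case: ifP.
pose x := D * (K * t); pose y := D * (K * (a / M%:R)).
have -> : 22 * D * K = 2 * (K * D + 2 * D * 1 * (K * 5)) by ring.
apply: (@renewal _ s D p pP (fun d => K%:E * ker d)%E
  (fun d => K%:E * (if (absz d <= 2)%N then 1 else 0))%E _ K (K * (5 * h + 4 * t))).
- by move=> d; rewrite mule_ge0// lee_fin ltW.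
- by move=> d; rewrite mule_ge0// lee_fin ltW.
- exact: ltW.
- by rewrite mulr_ge0// ltW.
- exact: ler01.
- by apply: block_decay_le; rewrite // ltW.
- by apply: (block_decay_renewal (a := a)) => //; exact: ltW.
- rewrite esumZ ?(ltW K0)// EFinM lee_wpmul2l ?lee_fin ?(ltW K0)//.
  exact: esum_kernel nL h0 u0 ut.
- have -> : 2 * D * (K * (5 * h + 4 * t)) = 10 * (D * (K * h)) + 8 * x.
    by rewrite /x; ring.
  have -> : D * (K * h) = 6 * y + 2 * x by rewrite hE /x /y; ring.
  have : 56 * x <= 1 by rewrite /x mulrA.
  have : 120 * y <= 1 by rewrite /y mulrA.
  lra.
- apply: (le_trans (decay_scale pP (ltW K0) i0)).
  by rewrite EFinM lee_wpmul2l ?lee_fin ?(ltW K0)//; exact: decay_near pP.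
- apply: (le_trans (decay_scale pP (ltW K0) ker0)).
  apply: (@le_trans _ _ (K%:E * (h * D + t)%:E)%E).
    by rewrite lee_wpmul2l ?lee_fin ?(ltW K0)//; exact: (decay_kernel n pP).
  rewrite -EFinM lee_fin.
  have -> : K * (h * D + t) = D * (K * h) + K * t by ring.
  have -> : D * (K * h) = 6 * y + 2 * x by rewrite hE /x /y; ring.
  have : 56 * x <= 1 by rewrite /x mulrA.
  have : 120 * y <= 1 by rewrite /y mulrA.
  have : K * t <= x by rewrite /x ler_peMl// mulr_ge0// ltW.
  lra.
- rewrite esumZ ?(ltW K0)// EFinM lee_wpmul2l ?lee_fin ?(ltW K0)//.
  exact: esum_near.
Qed.

(** The block lengths are chosen as small as [block_decay_bound] permits:
    [n ~ (K N)^(1/s)] and [M ~ K a].  The bound is then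
    [K (n M)^(s+1) ~ K (K N)^(1+1/s) (K a)^(s+1)]. *)
Lemma decay_inverse (s D : R) p : decay_norm s D p ->
  exists2 C : R, 0 <= C & forall (A B : bop) (a K N : R),
    A * B = 1 -> B * A = 1 -> opnorm A = a%:E -> opnorm B = K%:E ->
    p (diag_sup (bop_mx A)) = N%:E ->
    [/\ 0 < a, 0 < K, 1 <= a * K, a <= D * N &
       (p (diag_sup (bop_mx B)) <=
         (C * N `^ (1 + 1 / s) * a `^ (s + 1) * K `^ (s + 1 / s + 3))%:E)%E].
Proof.
move=> pP; have D1 := decay_ge1 pP; have s0 := decay_gt0 pP.
have D0 : 0 < D by lra.
have s1 : 0 <= s + 1 by lra.
have e0 : 0 <= 1 + 1 / s by rewrite addr_ge0// divr_ge0// ltW.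
exists (22 * D ^+ 2 * 4 `^ (s + 1) * (56 * D ^+ 2) `^ (1 + 1 / s)
          * (120 * D) `^ (s + 1)).
  by rewrite !mulr_ge0 ?powR_ge0 ?exprn_ge0// ltW.
move=> A B a K N AB BA oA oB pA.
have Aa x : l2norm (A x) <= a * l2norm x by exact: opnorm_bound.
have BK x : l2norm (B x) <= K * l2norm x by exact: opnorm_bound.
have a0 : 0 <= a by have [a' a'0] := opnorm_fin A; rewrite oA => -[->].
have K0 : 0 <= K by have [K' K'0] := opnorm_fin B; rewrite oB => -[->].
have aK : 1 <= a * K.
  rewrite -(l2norm_unitvec R 0) -{1}[unitvec R 0]/((1 : bop) (unitvec R 0)) -AB.
  apply: (le_trans (Aa _)); rewrite -[leRHS]mulr1 -mulrA ler_wpM2l//.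
  by rewrite -(l2norm_unitvec R 0).
have a_gt0 : 0 < a by rewrite lt_def a0 andbT; apply: contraTneq aK => ->; rewrite mul0r ler10.
have K_gt0 : 0 < K by rewrite lt_def K0 andbT; apply: contraTneq aK => ->; rewrite mulr0 ler10.
have u0 e : (0 <= diag_sup (bop_mx A) e)%E by exact: diag_sup_ge0.
have aDN : a <= D * N.
  rewrite -lee_fin -oA; apply: opnorm_le_sum; rewrite -esum_tail1.
  apply: (le_trans (decay_tail pP _ u0)) => //.
  by rewrite pA powR1 mulr1 EFinM.
have N_gt0 : 0 < N.
  by rewrite -(pmulr_rgt0 _ D0); exact: lt_le_trans aDN.
split => //.
have KN : 1 <= D * (K * N).
  apply: (le_trans aK); rewrite mulrC mulrCA ler_wpM2l//.
have X1 : 1 <= 56 * D ^+ 2 * (K * N).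
  have -> : 56 * D ^+ 2 * (K * N) = 56 * D * (D * (K * N)) by ring.
  nra.
have X0 : 0 <= 56 * D ^+ 2 * (K * N) by lra.
have Y1 : 1 <= (56 * D ^+ 2 * (K * N)) `^ s^-1.
  have : 1 `^ s^-1 <= (56 * D ^+ 2 * (K * N)) `^ s^-1.
    by apply: le_powR2 => //; rewrite invr_ge0 ltW.
  by rewrite powR1.
have Z1 : 1 <= 120 * D * (K * a) by rewrite (mulrC K); nra.
have [n [n0 nY nY2]] := nat_above Y1.
have [M [M0 MZ MZ2]] := nat_above Z1.
have L0 : (0 < n * M)%N by rewrite muln_gt0 n0.
have b0 := @block_decay_ge0 R B (n * M).
have nX : 56 * D ^+ 2 * (K * N) <= n%:R `^ s.
  have {1}-> : 56 * D ^+ 2 * (K * N) = ((56 * D ^+ 2 * (K * N)) `^ s^-1) `^ s.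
    by rewrite -powRrM mulVf ?gt_eqF// powRr1.
  by apply: le_powR2; rewrite ?powR_ge0// ltW.
have := block_decay_bound pP AB BA a_gt0 K_gt0 (ltW N_gt0) Aa BK pA n0 M0 nX MZ.
move=> pb.
apply: (@le_trans _ _ (p (fun e => block_decay B (n * M) (e %/ (n * M)%:Z)%Z
    + block_decay B (n * M) ((e %/ (n * M)%:Z)%Z + 1)%R))%E).
  by apply: decay_le pP _ _ _ => e; exact: diag_sup_block.
apply: (le_trans (decay_dilate pP L0 b0)).
have P0 : 0 <= D * (n * M)%:R `^ (s + 1) by rewrite mulr_ge0 ?powR_ge0// ltW.
apply: (@le_trans _ _ ((D * (n * M)%:R `^ (s + 1))%:E * (22 * D * K)%:E)%E).
  by rewrite lee_wpmul2l.
rewrite -EFinM lee_fin.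
set X := 56 * D ^+ 2 * (K * N) in X0 Y1 nY2 *.
set Z := 120 * D * (K * a) in Z1 MZ2 *.
have LYZ : (n * M)%:R `^ (s + 1) <=
    4 `^ (s + 1) * (X `^ (1 + 1 / s) * Z `^ (s + 1)) :> R.
  have XE : X `^ (1 + 1 / s) = (X `^ s^-1) `^ (s + 1).
    by rewrite -powRrM; congr (_ `^ _); field; rewrite gt_eqF.
  have Y0 : 0 <= X `^ s^-1 by lra.
  have Z0 : 0 <= Z by lra.
  rewrite XE -(powRM (s + 1) Y0 Z0) -(powRM (s + 1) (ler0n R 4) (mulr_ge0 Y0 Z0)).
  apply: le_powR2 => //.
  rewrite natrM; apply: (@le_trans _ _ ((2 * X `^ s^-1) * (2 * Z))).
    by apply: ler_pM.
  by rewrite le_eqVlt; apply/orP; left; apply/eqP; ring.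
apply: (@le_trans _ _ (D * (4 `^ (s + 1) * (X `^ (1 + 1 / s) * Z `^ (s + 1)))
    * (22 * D * K))).
  apply: ler_wpM2r; first by rewrite !mulr_ge0// ltW.
  by apply: ler_wpM2l => //; exact: ltW.
have XE : X `^ (1 + 1 / s) =
    (56 * D ^+ 2) `^ (1 + 1 / s) * (K `^ (1 + 1 / s) * N `^ (1 + 1 / s)).
  by rewrite /X !powRM ?mulr_ge0 ?exprn_ge0// ltW.
have ZE : Z `^ (s + 1) = (120 * D) `^ (s + 1) * (K `^ (s + 1) * a `^ (s + 1)).
  by rewrite /Z !(@powRM _ _ _ (s + 1)) ?mulr_ge0// ltW.
have KE : K `^ (s + 1 / s + 3) = K `^ (1 + 1 / s) * K `^ (s + 1) * K.
  have -> : s + 1 / s + 3 = (1 + 1 / s) + (s + 1) + 1 by ring.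
  by rewrite (powRD_gt0 (1 + 1 / s + (s + 1)) 1)// (powRD_gt0 (1 + 1 / s))// powRr1.
by rewrite XE ZE KE le_eqVlt; apply/orP; left; apply/eqP; ring.
Qed.

Local Open Scope ereal_scope.

(** Multiplying the bound of [decay_inverse] by [(a K)^(s + 1/s + 2) >= 1] yields
    the stated exponents; then [a <= D N] eliminates [a]. *)
Lemma norm_controlled_inversion (s D : R) p : decay_norm s D p ->
  exists C C' : R, forall A : bop, A \is a GRing.unit ->
    p (diag_sup (bop_mx A)) < +oo ->
  [/\ p (diag_sup (bop_mx (A^-1)%R)) < +oo,
      p (diag_sup (bop_mx (A^-1)%R)) <=
        C%:E * p (diag_sup (bop_mx A)) `^ (1 + 1 / s)%R *
        opnorm A `^ (2 * s + 1 / s + 3)%R *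
        opnorm (A^-1)%R `^ (2 * s + 2 / s + 5)%R,
      C%:E * p (diag_sup (bop_mx A)) `^ (1 + 1 / s)%R *
        opnorm A `^ (2 * s + 1 / s + 3)%R *
        opnorm (A^-1)%R `^ (2 * s + 2 / s + 5)%R <=
        C'%:E * p (diag_sup (bop_mx A)) `^ (2 * s + 2 / s + 4)%R *
        opnorm (A^-1)%R `^ (2 * s + 2 / s + 5)%R
    & forall delta : R, (0 < delta)%R ->
        p (diag_sup (bop_mx A)) <= 1 ->
        opnorm (A^-1)%R <= (1 / delta)%:E ->
        p (diag_sup (bop_mx (A^-1)%R)) <=
          (C' * delta `^ (- (2 * s) - 2 / s - 5))%:E ].
Proof.
move=> pP; have D1 := decay_ge1 pP; have s0 := decay_gt0 pP.
have [C C0 CP] := decay_inverse pP.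
have si : (0 <= 1 / s)%R by rewrite divr_ge0// ltW.
exists C, (C * D `^ (2 * s + 1 / s + 3))%R => A Au pA.
have AB : (A * A^-1 = 1)%R by rewrite mulrV.
have BA : (A^-1 * A = 1)%R by rewrite mulVr.
set B := (A^-1)%R in AB BA *.
have [a a0 oA] := opnorm_fin A; have [K K0 oB] := opnorm_fin B.
have u0 e : 0 <= diag_sup (bop_mx A) e by exact: diag_sup_ge0.
have [N pN] : exists N : R, p (diag_sup (bop_mx A)) = N%:E.
  have := decay_tail pP (ltn0Sn 0) u0.
  rewrite esum_tail1 powR1 mulr1; case: (p _) pA => [N|//|] _; first by exists N.
  rewrite gt0_muleNy ?lte_fin; last by lra.
  by rewrite leeNy_eq => /eqP h; have := esum_ge0 (fun e (_ : [set: int] e) => u0 e); rewrite h.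
have [a_gt0 K_gt0 aK aDN pB] := CP A B a K N AB BA oA oB pN.
have N_gt0 : (0 < N)%R.
  by have := lt_le_trans a_gt0 aDN; rewrite pmulr_rgt0//; lra.
set E := (2 * s + 2 / s + 5)%R.
have s2 : (0 <= 2 / s)%R by rewrite divr_ge0// ltW.
have E0 : (0 <= E)%R by rewrite /E; lra.
have main : (C * N `^ (1 + 1 / s) * a `^ (s + 1) * K `^ (s + 1 / s + 3) <=
    C * N `^ (1 + 1 / s) * a `^ (2 * s + 1 / s + 3) * K `^ E)%R.
  rewrite -!mulrA ler_wpM2l// ler_wpM2l ?powR_ge0//.
  have -> : (2 * s + 1 / s + 3 = (s + 1) + (s + 1 / s + 2))%R by ring.
  have -> : E = ((s + 1 / s + 3) + (s + 1 / s + 2))%R by rewrite /E; ring.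
  rewrite (powRD_gt0 (s + 1))// (powRD_gt0 (s + 1 / s + 3))//.
  rewrite mulrACA -powRM// ler_peMr ?mulr_ge0 ?powR_ge0//.
  rewrite -[X in (X <= _)%R](powRr0 (a * K)) ler_powR//; lra.
have second : (C * N `^ (1 + 1 / s) * a `^ (2 * s + 1 / s + 3) * K `^ E <=
    C * D `^ (2 * s + 1 / s + 3) * N `^ (2 * s + 2 / s + 4) * K `^ E)%R.
  rewrite ler_wpM2r ?powR_ge0// -!mulrA ler_wpM2l//.
  have -> : (2 * s + 2 / s + 4 = (1 + 1 / s) + (2 * s + 1 / s + 3))%R by ring.
  rewrite (powRD_gt0 (1 + 1 / s))//.
  rewrite mulrCA ler_wpM2l ?powR_ge0// -powRM ?(ltW N_gt0)//; last by lra.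
  by apply: le_powR2 => //; lra.
rewrite oA oB pN !poweR_EFin -!EFinM !lee_fin; split => //.
- exact: le_lt_trans pB (ltry _).
- by apply: (le_trans pB); rewrite lee_fin.
move=> delta delta0 N1 Kd; apply: (le_trans pB); rewrite lee_fin.
apply: (le_trans main); apply: (le_trans second).
have D'0 : (0 <= C * D `^ (2 * s + 1 / s + 3))%R by rewrite mulr_ge0 ?powR_ge0.
rewrite -mulrA ler_wpM2l//.
have -> : (delta `^ (- (2 * s) - 2 / s - 5) = (1 / delta) `^ E)%R.
  rewrite div1r -(powR_inv1 (ltW delta0)) -powRrM; congr (_ `^ _)%R.
  by rewrite /E; ring.
rewrite -[leRHS]mul1r; apply: ler_pM; rewrite ?powR_ge0//; last exact: le_powR2.
have e0 : (0 <= 2 * s + 2 / s + 4)%R by lra.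
rewrite ?lee_fin in N1 Kd.
by have := le_powR2 e0 (ltW N_gt0) N1; rewrite powR1.
Qed.

End quantitative.

(** * The convolution-dominated and Jaffard algebras *)

Local Open Scope ereal_scope.

(** The supremum over all pairs is taken diagonal by diagonal. *)
Lemma jaffard_normE (R : realType) (r : R) m :
  jaffard_norm r m = decay_sup r (diag_sup m).
Proof.
apply/eqP; rewrite eq_le; apply/andP; split.
  apply: ge_ereal_sup => _ [[i j] _ <-] /=.
  apply: (@le_trans _ _ (wgt r (diag_sup m) (i - j)%R)).
    rewrite EFinM lee_wpmul2r ?lee_fin ?powR_ge0//; exact: diag_sup_ge.
  by apply: ereal_sup_ubound; exists (i - j)%R.
apply: ge_ereal_sup => _ [d _ <-].
have w0 : (0 < weight r d)%R by exact: weight_gt0.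
rewrite /wgt -lee_pdivlMr//; apply: ge_ereal_sup => _ [l _ <-].
rewrite lee_pdivlMr// -EFinM; apply: ereal_sup_ubound.
by exists (l, l - d)%R => //=; rewrite subKr.
Qed.

Theorem proposition3p3 (R : realType) :
  (forall r : R, (0 < r)%R ->
    exists C C' : R, forall A : bop R,
      A \is a GRing.unit -> convdom r (bop_mx A) ->
      [/\ convdom r (bop_mx (A^-1)%R),
          convdom_norm r (bop_mx (A^-1)%R) <=
            C%:E * convdom_norm r (bop_mx A) `^ (1 + 1 / r)%R *
            opnorm A `^ (2 * r + 1 / r + 3)%R *
            opnorm (A^-1)%R `^ (2 * r + 2 / r + 5)%R,
          C%:E * convdom_norm r (bop_mx A) `^ (1 + 1 / r)%R *
            opnorm A `^ (2 * r + 1 / r + 3)%R *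
            opnorm (A^-1)%R `^ (2 * r + 2 / r + 5)%R <=
            C'%:E * convdom_norm r (bop_mx A) `^ (2 * r + 2 / r + 4)%R *
            opnorm (A^-1)%R `^ (2 * r + 2 / r + 5)%R
        & forall delta : R, (0 < delta)%R ->
            convdom_norm r (bop_mx A) <= 1 ->
            opnorm (A^-1)%R <= (1 / delta)%:E ->
            convdom_norm r (bop_mx (A^-1)%R) <=
              (C' * delta `^ (- (2 * r) - 2 / r - 5))%:E ])
  /\
  (forall r : R, (1 < r)%R ->
    exists C C' : R, forall A : bop R,
      A \is a GRing.unit -> jaffard r (bop_mx A) ->
      [/\ jaffard r (bop_mx (A^-1)%R),
          jaffard_norm r (bop_mx (A^-1)%R) <=
            C%:E * jaffard_norm r (bop_mx A) `^ (1 + 1 / (r - 1))%R *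
            opnorm A `^ (2 * r + 1 + 1 / (r - 1))%R *
            opnorm (A^-1)%R `^ (2 * r + 3 + 2 / (r - 1))%R,
          C%:E * jaffard_norm r (bop_mx A) `^ (1 + 1 / (r - 1))%R *
            opnorm A `^ (2 * r + 1 + 1 / (r - 1))%R *
            opnorm (A^-1)%R `^ (2 * r + 3 + 2 / (r - 1))%R <=
            C'%:E * jaffard_norm r (bop_mx A) `^ (2 * r + 2 + 2 / (r - 1))%R *
            opnorm (A^-1)%R `^ (2 * r + 3 + 2 / (r - 1))%R
        & forall delta : R, (0 < delta)%R ->
            jaffard_norm r (bop_mx A) <= 1 ->
            opnorm (A^-1)%R <= (1 / delta)%:E ->
            jaffard_norm r (bop_mx (A^-1)%R) <=
              (C' * delta `^ (- (2 * r) - 2 / (r - 1) - 3))%:E ]).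
Proof.
split => r r0.
  (* [convdom_norm r m] is [decay_l1 r (diag_sup m)] by definition. *)
  have [C [C' CP]] := norm_controlled_inversion (decay_norm_l1 r0).
  by exists C, C' => A Au Ar; have := CP A Au Ar.
have s0 : (0 < r - 1)%R by rewrite subr_gt0.
have [C [C' CP]] := norm_controlled_inversion (decay_norm_sup s0).
exists C, C' => A Au Ar.
rewrite !jaffard_normE /jaffard /= jaffard_normE.
rewrite /jaffard /= jaffard_normE in Ar.
have := CP A Au; rewrite subrK => /(_ Ar).
set s := (r - 1)%R.
have -> : (2 * r + 1 + 1 / s = 2 * s + 1 / s + 3)%R by rewrite /s; ring.
have -> : (2 * r + 3 + 2 / s = 2 * s + 2 / s + 5)%R by rewrite /s; ring.
have -> : (2 * r + 2 + 2 / s = 2 * s + 2 / s + 4)%R by rewrite /s; ring.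
have -> : (- (2 * r) - 2 / s - 3 = - (2 * s) - 2 / s - 5)%R by rewrite /s; ring.
by move=> [h1 h2 h3 h4]; split.
Qed.
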